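(* For all $r\in\mathbb{R}$ and $|z|<4/27$ we have \[ \mathcal{D}_{3,r}(z)=\left(\frac{3}{3\cos^2\alpha-\sin^2\alpha}\right)^{r}\frac{1}{\cos^2\alpha-3\sin^2\alpha}, \] where $\alpha=\frac13\arcsin\left(\sqrt{27z/4}\right)$.
   Context: For $a\in\mathbb{R}$ and $n\in\{0,1,2,\ldots\}$, $\binom{a}{n}:=a(a-1)\cdots(a-n+1)/n!$ (with $\binom a0=1$). For $p,r\in\mathbb{R}$, $\mathcal{D}_{p,r}(z):=\sum_{n=0}^\infty\binom{np+r}{n}z^n$ (convergent in a neighbourhood of $0$). The maps $u\mapsto\cos^2(\frac13\arcsin u)$ and $u\mapsto\sin^2(\frac13\arcsin u)$ are even, so $\cos^2\alpha$ and $\sin^2\alpha$ are well-defined analytic functions of $z$ on $|z|<4/27$ regardless of the choice of the square root. The power with exponent $r$ denotes the analytic branch equal to $1$ at $z=0$. *)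

(* Defs.v *)
From Stdlib Require Import Reals Factorial.
From Coquelicot Require Import Coquelicot.
Open Scope R_scope.

Fixpoint falling (a : R) (n : nat) : R :=
  match n with
  | O => 1
  | S m => falling a m * (a - INR m)
  end.

Definition gbinom (a : R) (n : nat) : R := falling a n / INR (fact n).

(* [is_Dseries p r z l]: the complex power series D_{p,r} converges at [z], with sum [l]. *)
Definition is_Dseries (p r : R) (z l : C) : Prop :=
  @is_pseries C_AbsRing C_NormedModule
    (fun n => RtoC (gbinom (INR n * p + r) n)) z l.

Open Scope C_scope.

Definition Cexp (z : C) : C :=
  (exp (Re z) * cos (Im z), exp (Re z) * sin (Im z))%R.

Definition Ccos (z : C) : C := (Cexp (Ci * z) + Cexp (- (Ci * z))) / 2.

Definition Csin (z : C) : C := (Cexp (Ci * z) - Cexp (- (Ci * z))) / (2 * Ci).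

(* Principal argument, in (-PI, PI]: the half-angle formula off the negative real axis, where
   |z| + Re z > 0. The value at 0 is irrelevant. *)
Definition Carg (z : C) : R :=
  (if Rlt_dec 0 (Cmod z + Re z)
   then 2 * atan (Im z / (Cmod z + Re z))
   else PI)%R.

Definition Clog (z : C) : C := (ln (Cmod z), Carg z).

(* Principal square root: nonnegative real part, imaginary part of the sign of [Im z]. *)
Definition Csqrt (z : C) : C :=
  (sqrt ((Cmod z + Re z) / 2),
   (if Rle_dec 0 (Im z) then 1 else -1) * sqrt ((Cmod z - Re z) / 2))%R.

(* Principal branch; analytic off the real half-lines |u| >= 1, hence on the unit disc. *)
Definition Carcsin (u : C) : C := - (Ci * Clog (Ci * u + Csqrt (1 - u * u))).

(* Complex differentiability at every point of the open set [U]. *)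
Definition analytic_on (U : C -> Prop) (f : C -> C) : Prop :=
  forall z, U z -> @ex_derive C_AbsRing C_NormedModule f z.

(* [P] is the analytic branch of [f ^ r] on [U] normalized by [P 0 = 1]: it is [exp (r * L)] for
   an analytic logarithm [L] of [f] on [U]. When [U] is connected and contains 0, two such
   logarithms differ by a constant, so [P] is determined on [U]. Nothing is said off [U]. *)
Definition is_power_branch (U : C -> Prop) (f : C -> C) (r : R) (P : C -> C) : Prop :=
  P 0 = 1 /\
  exists L : C -> C,
    analytic_on U L /\
    (forall z, U z -> Cexp (L z) = f z) /\
    (forall z, U z -> P z = Cexp (RtoC r * L z)).

(* [sq] is the chosen square root. *)
Definition alpha (sq : C -> C) (z : C) : C := Carcsin (sq (27 * z / 4)) / 3.

Definition cos2a (sq : C -> C) (z : C) : C := Ccos (alpha sq z) * Ccos (alpha sq z).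

Definition sin2a (sq : C -> C) (z : C) : C := Csin (alpha sq z) * Csin (alpha sq z).

Definition open_disc (rho : R) (z : C) : Prop := (Cmod z < rho)%R.

(* Main.v *)
(* With [t = 4/3 sin^2 alpha] one has [t (1 - t)^2 = z], the base of the power is
   [B = 1 / (1 - t)], which solves [B = 1 + z B^3], and the second factor is [1 / (1 - 3 t)].
   Write [A_s] for the formal series of [B^s], so that [A_s = 3 D_(s-1) - 2 D_s].
   The Rothe-Hagen convolution [D_r A_s = D_(r+s)] gives the relations [A_r A_s = A_(r+s)] and
   [A_s - A_(s-1) = z A_(s+2)], and these hold for the sums on the whole disc [|z| < 4/27].
   Hence [T = 1 - A_(-1)] satisfies the same cubic equation as [t]. Both lie in [|t| < 1/3]:
   for [t] because [Re t < 1/3], for [T] by continuity along a ray, since [|t| = 1/3] forces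
   [|z| >= 4/27]. The cubic is injective there, so [T = t]. Finally
   [D_r = A_r / (1 - 3 t)], and [A_r] is the power branch [B^r] because both solve the same
   first-order linear differential equation along rays. *)

Require Import Defs.
From Stdlib Require Import Reals Lra Lia Factorial Ranalysis5.
From Coquelicot Require Import Coquelicot.
Open Scope R_scope.

(** * Binomial coefficients and the Rothe-Hagen convolution *)

(** The square root [sq] is an arbitrary pointwise choice, possibly discontinuous, so the regularity
    of sin^2 alpha cannot come from composing it with the arcsine. Only two facts are taken from the
    arcsine: the cubic equation, which is the squared triple-angle formula in the form sin^2 (3 a) =
    27/4 t (1 - t)^2, and the bound |t| < 1/3. Continuity and differentiability of t are then
    deduced from the cubic itself. The number 4/27 appears twice independently: as the value of the
    cubic at its critical point 1/3, where the derivative (1 - t)(1 - 3 t) vanishes, and as the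
    inverse of the limit 3^3 / 2^2 of the coefficient ratios. Working along x z with 0 <= x <= 1
    turns a complex power series into two real ones and gives a path from 0 for the continuity and
    uniqueness arguments. The price is a differential equation in which the derivative is multiplied
    by x, so that it is silent at x = 0. *)

Lemma falling_front (x : R) (n : nat) : falling x (S n) = x * falling (x - 1) n.
Proof.
  induction n as [|n IH]; [simpl; ring|].
  change (falling x (S (S n))) with (falling x (S n) * (x - INR (S n))).
  rewrite IH, S_INR. simpl. ring.
Qed.

Lemma INR_fact_S (n : nat) : INR (fact (S n)) = (INR n + 1) * INR (fact n).
Proof. now rewrite fact_simpl, mult_INR, S_INR. Qed.

Lemma gbinom_pascal (x : R) (n : nat) :
  gbinom x (S n) = gbinom (x - 1) (S n) + gbinom (x - 1) n.
Proof.
  unfold gbinom. rewrite falling_front, INR_fact_S. simpl falling.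
  generalize (INR_fact_neq_0 n) (pos_INR n). intros Hf Hn. field. split; lra.
Qed.

Lemma gbinom_shift (x : R) (n : nat) :
  x * gbinom (x - 1) n = (x - INR n) * gbinom x n.
Proof.
  unfold gbinom, Rdiv. rewrite <- Rmult_assoc, <- falling_front. simpl. ring.
Qed.

(** Both sides come from the falling factorial of x + 3 of length n + 3, split off at the front or
    at the back. Keeping it as a product avoids assuming that any of the linear factors is
    nonzero. *)
Lemma gbinom_step3 (x : R) (n : nat) :
  gbinom (x + 3) (S n) * ((INR n + 1) * (x - INR n + 2) * (x - INR n + 1))
  = (x + 3) * (x + 2) * (x + 1) * gbinom x n.
Proof.
  assert (H : falling (x + 3) (S (S (S n)))
            = (x + 3) * ((x + 2) * ((x + 1) * falling x n))).
  { rewrite !falling_front. replace (x + 3 - 1) with (x + 2) by ring.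
    replace (x + 2 - 1) with (x + 1) by ring. now replace (x + 1 - 1) with x by ring. }
  unfold gbinom. rewrite INR_fact_S.
  change (falling (x + 3) (S (S (S n)))) with
    (falling (x + 3) (S n) * (x + 3 - INR (S n)) * (x + 3 - INR (S (S n)))) in H.
  rewrite !S_INR in H.
  generalize (INR_fact_neq_0 n) (pos_INR n). intros Hf Hn.
  apply Rmult_eq_reg_r with (INR (fact n)); [|assumption].
  transitivity (falling (x + 3) (S n) * (x - INR n + 2) * (x - INR n + 1)).
  { field. split; lra. }
  transitivity ((x + 3) * ((x + 2) * ((x + 1) * falling x n))); [|field; assumption].
  rewrite <- H. ring.
Qed.

Definition dcoef (r : R) (n : nat) : R := gbinom (INR n * 3 + r) n.

(* Coefficients of the [s]-th power of the solution [B] of [B = 1 + z B^3]; for [n <> 0] this is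
   the Fuss-Catalan number [s / (3 n + s) * binom (3 n + s) n]. The linear form below has no
   division, so the difference equation in [s] is inherited from [dcoef]. *)
Definition acoef (s : R) (n : nat) : R := 3 * dcoef (s - 1) n - 2 * dcoef s n.

Lemma dcoef_0 (r : R) : dcoef r 0 = 1.
Proof. unfold dcoef, gbinom. simpl. field. Qed.

(** Pascal's rule: going from n + 1 down to n lowers 3 n by 3, which turns the offset r - 1 into r +
    2. *)
Lemma dcoef_diff (r : R) (n : nat) :
  dcoef r (S n) - dcoef (r - 1) (S n) = dcoef (r + 2) n.
Proof.
  unfold dcoef. rewrite gbinom_pascal, S_INR.
  replace ((INR n + 1) * 3 + r - 1) with ((INR n + 1) * 3 + (r - 1)) by ring.
  replace (INR n * 3 + (r + 2)) with ((INR n + 1) * 3 + (r - 1)) by ring.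
  ring.
Qed.

Lemma dcoef_shift (r : R) (n : nat) :
  (INR n * 3 + r) * dcoef (r - 1) n = (INR n * 2 + r) * dcoef r n.
Proof.
  unfold dcoef. generalize (gbinom_shift (INR n * 3 + r) n).
  replace (INR n * 3 + (r - 1)) with (INR n * 3 + r - 1) by ring.
  intros ->. ring.
Qed.

Lemma dcoef_ratio (r : R) (n : nat) :
  dcoef r (S n) * ((INR n + 1) * (INR n * 2 + r + 2) * (INR n * 2 + r + 1))
  = (INR n * 3 + r + 3) * (INR n * 3 + r + 2) * (INR n * 3 + r + 1) * dcoef r n.
Proof.
  unfold dcoef. rewrite <- gbinom_step3, S_INR.
  replace ((INR n + 1) * 3 + r) with (INR n * 3 + r + 3) by ring.
  ring.
Qed.

Lemma acoef_0 (s : R) : acoef s 0 = 1.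
Proof. unfold acoef. rewrite !dcoef_0. ring. Qed.

Lemma acoef_diff (s : R) (n : nat) :
  acoef s (S n) - acoef (s - 1) (S n) = acoef (s + 2) n.
Proof.
  unfold acoef. replace (s + 2 - 1) with (s - 1 + 2) by ring.
  rewrite <- !dcoef_diff. ring.
Qed.

(** Formally B^0 = 1. For r = 0 the shift relation reads 3 n d = 2 n d', and a positive index can be
    cancelled. *)
Lemma acoef_zero_S (n : nat) : acoef 0 (S n) = 0.
Proof.
  unfold acoef. generalize (dcoef_shift 0 (S n)) (pos_INR n). rewrite S_INR.
  intros H Hn. apply Rmult_eq_reg_l with (INR n + 1); lra.
Qed.

(** Coefficient form of 3 z A_r' = r (D_r - A_r), the source of the differential equation used along
    rays. *)
Lemma acoef_euler (r : R) (n : nat) :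
  3 * INR n * acoef r n = r * (dcoef r n - acoef r n).
Proof. unfold acoef. generalize (dcoef_shift r n). intros H. lra. Qed.

(** Horner form of a polynomial function of degree less than [d], so index 0 leaves only the zero
    function. No list of coefficients is ever needed. *)
Fixpoint polyfun (d : nat) (f : R -> R) : Prop :=
  match d with
  | O => forall x, f x = 0
  | S d => exists c g, polyfun d g /\ forall x, f x = c + x * g x
  end.

Lemma polyfun_ext (d : nat) (f g : R -> R) :
  (forall x, f x = g x) -> polyfun d f -> polyfun d g.
Proof.
  destruct d; simpl; intros E H.
  - intros x. now rewrite <- E.
  - destruct H as (c & h & Hh & Hf). exists c, h. split; [assumption|].
    intros x. now rewrite <- E.
Qed.

Lemma polyfun_S (d : nat) (f : R -> R) : polyfun d f -> polyfun (S d) f.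
Proof.
  revert f. induction d as [|d IH]; intros f H.
  - exists 0, (fun _ => 0). split; [now intros ?|]. intros x. rewrite (H x). ring.
  - destruct H as (c & g & Hg & Hf). exists c, g. split; [now apply IH|assumption].
Qed.

Lemma polyfun_le (d e : nat) (f : R -> R) : (d <= e)%nat -> polyfun d f -> polyfun e f.
Proof. induction 1; [trivial|]. intros H'. now apply polyfun_S, IHle. Qed.

Lemma polyfun_lin (d : nat) (a b : R) (f g : R -> R) :
  polyfun d f -> polyfun d g -> polyfun d (fun x => a * f x + b * g x).
Proof.
  revert f g. induction d as [|d IH]; intros f g.
  - simpl. intros Hf Hg x. rewrite Hf, Hg. ring.
  - intros (c & h & Hh & Hf) (c' & h' & Hh' & Hg).
    exists (a * c + b * c'), (fun x => a * h x + b * h' x).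
    split; [now apply IH|]. intros x. rewrite Hf, Hg. ring.
Qed.

Lemma polyfun_mul_affine (d : nat) (a b : R) (f : R -> R) :
  polyfun d f -> polyfun (S d) (fun x => (a * x + b) * f x).
Proof.
  intros H. apply polyfun_ext with (fun x => 1 * (x * (a * f x)) + b * f x).
  - intros x. ring.
  - apply polyfun_lin; [|now apply polyfun_S].
    exists 0, (fun x => a * f x). split; [|intros; ring].
    apply polyfun_ext with (fun x => a * f x + 0 * f x); [intros; ring|].
    now apply polyfun_lin.
Qed.

Lemma polyfun_factor (d : nat) (f : R -> R) (b : R) :
  polyfun (S d) f -> exists g, polyfun d g /\ forall x, f x = f b + (x - b) * g x.
Proof.
  revert f. induction d as [|d IH]; intros f (c & g & Hg & Hf).
  - exists g. split; [assumption|]. intros x. rewrite !Hf, !Hg. ring.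
  - destruct (IH g Hg) as (h & Hh & Hgh).
    exists (fun x => 1 * g x + b * h x). split.
    + apply polyfun_lin; [assumption|now apply polyfun_S].
    + intros x. rewrite !Hf, (Hgh x). ring.
Qed.

(** The zero at [k] is split off and the quotient still vanishes at every integer from [k + 1] on;
    this is why the starting point [k] varies in the induction. *)
Lemma polyfun_zero (d : nat) (f : R -> R) (k : nat) :
  polyfun d f -> (forall n, (k <= n)%nat -> f (INR n) = 0) -> forall x, f x = 0.
Proof.
  revert f k. induction d as [|d IH]; intros f k H Hz; [exact H|].
  destruct (polyfun_factor _ _ (INR k) H) as (g & Hg & Hfg).
  rewrite Hz in Hfg by lia.
  assert (G : forall x, g x = 0).
  { apply IH with (S k); [assumption|]. intros n Hn.
    generalize (Hfg (INR n)). rewrite Hz by lia. intros E.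
    apply lt_INR in Hn. apply Rmult_eq_reg_l with (INR n - INR k); lra. }
  intros x. rewrite Hfg, G. ring.
Qed.

Lemma polyfun_falling (b : R) (n : nat) : polyfun (S n) (fun s => falling (s + b) n).
Proof.
  induction n as [|n IH].
  - exists 1, (fun _ => 0). split; [now intros ?|]. intros x. simpl. ring.
  - apply polyfun_ext with (fun s => (1 * s + (b - INR n)) * falling (s + b) n).
    + intros s. simpl. ring.
    + now apply polyfun_mul_affine.
Qed.

Lemma polyfun_dcoef (b : R) (n : nat) : polyfun (S n) (fun s => dcoef (s + b) n).
Proof.
  apply polyfun_ext with
    (fun s => / INR (fact n) * falling (s + (INR n * 3 + b)) n
              + 0 * falling (s + (INR n * 3 + b)) n).
  - intros s. unfold dcoef, gbinom.
    replace (INR n * 3 + (s + b)) with (s + (INR n * 3 + b)) by ring.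
    field. apply INR_fact_neq_0.
  - apply polyfun_lin; apply polyfun_falling.
Qed.

Lemma polyfun_acoef (n : nat) : polyfun (S n) (fun s => acoef s n).
Proof.
  apply polyfun_ext with (fun s => 3 * dcoef (s + -1) n + -2 * dcoef (s + 0) n).
  - intros s. unfold acoef. rewrite Rplus_0_r. replace (s + -1) with (s - 1) by ring. ring.
  - apply polyfun_lin; apply polyfun_dcoef.
Qed.

Lemma polyfun_sum (d : nat) (f : nat -> R -> R) (c : nat -> R) (n : nat) :
  (forall k, (k <= n)%nat -> polyfun d (f k)) ->
  polyfun d (fun s => sum_f_R0 (fun k => c k * f k s) n).
Proof.
  induction n as [|n IH]; intros H; simpl.
  - apply polyfun_ext with (fun s => c O * f O s + 0 * f O s); [intros; ring|].
    apply polyfun_lin; now apply H.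
  - apply polyfun_ext with
      (fun s => 1 * sum_f_R0 (fun k => c k * f k s) n + c (S n) * f (S n) s).
    + intros; ring.
    + apply polyfun_lin; [apply IH; intros; apply H; lia|now apply H].
Qed.

(* Rothe-Hagen: both sides satisfy the same difference equation in [s], so by induction on [n]
   their difference is 1-periodic in [s]; it is a polynomial vanishing at [s = 0], hence 0. *)
Lemma dcoef_acoef_conv (n : nat) (r s : R) :
  PS_mult (dcoef r) (acoef s) n = dcoef (r + s) n.
Proof.
  revert r s. induction n as [|n IH]; intros r s.
  { unfold PS_mult. simpl. rewrite acoef_0, !dcoef_0. ring. }
  set (E := fun s => PS_mult (dcoef r) (acoef s) (S n) - dcoef (r + s) (S n)).
  assert (Hper : forall s, E s - E (s - 1) = 0).
  { intros u. unfold E.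
    assert (H : PS_mult (dcoef r) (acoef u) (S n)
              - PS_mult (dcoef r) (acoef (u - 1)) (S n)
              = PS_mult (dcoef r) (acoef (u + 2)) n).
    (* The last terms carry [acoef _ 0 = 1] and cancel. In the others the index S n - i is a
       successor, so [acoef_diff] applies termwise. *)
    { unfold PS_mult. rewrite !tech5, Nat.sub_diag, !acoef_0.
      match goal with |- ?a + ?b - (?c + ?b) = _ =>
        replace (a + b - (c + b)) with (a - c) by ring end.
      rewrite <- minus_sum. apply sum_eq. intros i Hi.
      rewrite Nat.sub_succ_l by assumption.
      rewrite <- (acoef_diff u). ring. }
    rewrite IH in H. generalize (dcoef_diff (r + u) n).
    replace (r + (u - 1)) with (r + u - 1) by ring.
    replace (r + (u + 2)) with (r + u + 2) in H by ring. lra. }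
  assert (H0 : E 0 = 0).
  { unfold E, PS_mult. rewrite tech5, Nat.sub_diag, acoef_0.
    rewrite (sum_eq _ (fun _ => 0)).
    - rewrite sum_cte, Rplus_0_r. ring.
    - intros i Hi. rewrite Nat.sub_succ_l by assumption. rewrite acoef_zero_S. ring. }
  assert (Hn : forall k, E (INR k) = 0).
  { induction k as [|k IHk]; [exact H0|].
    generalize (Hper (INR (S k))). rewrite S_INR.
    replace (INR k + 1 - 1) with (INR k) by ring. lra. }
  cut (E s = 0); [unfold E; lra|].
  apply polyfun_zero with (d := S (S n)) (k := O); [|intros; apply Hn].
  apply polyfun_ext with
    (fun s => 1 * sum_f_R0 (fun k => dcoef r k * acoef s (S n - k)%nat) (S n)
              + -1 * dcoef (s + r) (S n)).
  - intros u. unfold E, PS_mult. rewrite (Rplus_comm r u). ring.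
  - apply polyfun_lin; [|apply polyfun_dcoef].
    apply (polyfun_sum _ (fun k s => acoef s (S n - k)%nat)).
    intros k Hk. apply polyfun_le with (S (S n - k)); [lia|apply polyfun_acoef].
Qed.

Lemma acoef_conv (n : nat) (r s : R) :
  PS_mult (acoef r) (acoef s) n = acoef (r + s) n.
Proof.
  unfold acoef at 3. replace (r + s - 1) with (r - 1 + s) by ring.
  rewrite <- !dcoef_acoef_conv. unfold PS_mult. rewrite !scal_sum, <- minus_sum.
  apply sum_eq. intros i Hi. unfold acoef. ring.
Qed.

(** * Radius of convergence and sums along rays *)

Lemma falling_pos (x : R) (n : nat) : 0 < x - INR n + 1 -> 0 < falling x n.
Proof.
  induction n as [|n IH]; intros H; [simpl; lra|].
  rewrite S_INR in H. simpl. apply Rmult_lt_0_compat; [apply IH|]; lra.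
Qed.

Lemma dcoef_pos (r : R) (n : nat) : 0 < INR n * 2 + r + 1 -> 0 < dcoef r n.
Proof.
  intros H. unfold dcoef, gbinom. apply Rdiv_lt_0_compat; [|apply INR_fact_lt_0].
  apply falling_pos. lra.
Qed.

Lemma is_lim_seq_affine_ratio (a b c d : R) : 0 < c ->
  is_lim_seq (fun n => (INR n * a + b) / (INR n * c + d)) (a / c).
Proof.
  intros Hc.
  assert (H : is_lim_seq (fun n => INR n * c + d) p_infty).
  { apply is_lim_seq_plus with p_infty d; [|apply is_lim_seq_const|reflexivity].
    apply is_lim_seq_mult with p_infty c; [apply is_lim_seq_INR|apply is_lim_seq_const|].
    simpl. apply is_Rbar_mult_p_infty_pos. exact Hc. }
  apply is_lim_seq_ext_loc with (fun n => a / c + (b - a * d / c) * / (INR n * c + d)).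
  - assert (Hp : eventually (fun n => 0 < INR n * c + d))
      by exact (H _ (ex_intro _ 0 (fun x h => h))).
    revert Hp. apply filter_imp. intros n Hn. field. lra.
  - replace (a / c) with (a / c + (b - a * d / c) * 0) at 1 by ring.
    apply is_lim_seq_plus'; [apply is_lim_seq_const|].
    apply is_lim_seq_mult'; [apply is_lim_seq_const|].
    change (Finite 0) with (Rbar_inv p_infty). now apply is_lim_seq_inv.
Qed.

Lemma CV_radius_ge_of_disk (a : nat -> R) (rho : R) : 0 < rho ->
  (forall y, 0 <= y < rho -> CV_disk a y) -> Rbar_le rho (CV_radius a).
Proof.
  intros Hrho H. destruct (Lub_Rbar_correct (CV_disk a)) as [Hub _].
  fold (CV_radius a) in Hub.
  assert (H' : forall y, 0 <= y < rho -> Rbar_le y (CV_radius a))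
    by (intros y Hy; apply Hub, H, Hy).
  destruct (CV_radius a) as [l| |]; simpl in *; [|trivial|apply (H' 0); lra].
  apply Rnot_lt_le. intros Hl.
  assert (0 <= l) by (apply H'; lra).
  assert ((l + rho) / 2 <= l) by (apply H'; lra). lra.
Qed.

(** D'Alembert's test needs nonzero coefficients, but for negative r some early [dcoef r n] may
    vanish. Past an index exceeding |r| they are positive, so the test is run on the tail. *)
Lemma CV_radius_dcoef (r : R) : Rbar_le (4 / 27) (CV_radius (dcoef r)).
Proof.
  apply CV_radius_ge_of_disk; [lra|]. intros y Hy. unfold CV_disk.
  destruct (nfloor_ex (Rabs r)) as [N [_ HN]]; [apply Rabs_pos|].
  assert (Hr := Rle_abs (- r)). rewrite Rabs_Ropp in Hr.
  apply (ex_series_incr_n _ (S N)).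
  set (b := fun n => dcoef r (S N + n)).
  assert (Hb : forall n, 0 < b n).
  { intros n. apply dcoef_pos. rewrite plus_INR, S_INR.
    generalize (pos_INR n) (pos_INR N). lra. }
  apply ex_series_ext with (fun n => scal (Rabs (y ^ S N)) (Rabs (b n * y ^ n))).
  { intros n.
    change (Rabs (y ^ S N) * Rabs (b n * y ^ n)
            = Rabs (dcoef r (S N + n) * y ^ (S N + n))).
    rewrite pow_add, !Rabs_mult. unfold b. ring. }
  apply (ex_series_scal (V := R_NormedModule)).
  change (CV_disk b y). apply CV_disk_DAlembert with (27 / 4).
  - intros n. apply Rgt_not_eq, Hb.
  - set (g := fun n => (INR n * 3 + (r + 3)) / (INR n * 1 + 1)
       * ((INR n * 3 + (r + 2)) / (INR n * 2 + (r + 2)))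
       * ((INR n * 3 + (r + 1)) / (INR n * 2 + (r + 1)))).
    apply is_lim_seq_ext with (fun n => Rabs (g (n + S N)%nat)).
    + intros n. f_equal. unfold b. rewrite (Nat.add_comm n).
      replace (S N + S n)%nat with (S (S N + n)) by lia.
      generalize (dcoef_ratio r (S N + n)) (Hb n). fold (b n). unfold g.
      assert (0 < INR (S N + n) * 2 + r + 1).
      { rewrite plus_INR, S_INR. generalize (pos_INR n) (pos_INR N). lra. }
      generalize (pos_INR (S N + n)). intros H0 E Hp.
      match type of E with ?u * ?v = ?w =>
        replace u with (w / v) by (rewrite <- E; field; lra) end.
      field. repeat split; lra.
    (* The three factors are the linear ratios of [dcoef_ratio], with leading coefficients 3 over 1,
       2 and 2. *)
    + replace (27 / 4) with (Rabs (3 / 1 * (3 / 2) * (3 / 2)))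
        by (rewrite Rabs_pos_eq; lra).
      apply (is_lim_seq_abs _ (3 / 1 * (3 / 2) * (3 / 2))), (is_lim_seq_incr_n g).
      apply is_lim_seq_mult'; [apply is_lim_seq_mult'|];
        apply is_lim_seq_affine_ratio; lra.
  - right. split; [lra|]. rewrite Rabs_pos_eq by lra. lra.
Qed.

Lemma CV_radius_ge_lin (rho a b : R) (u v : nat -> R) : 0 < rho ->
  Rbar_le rho (CV_radius u) -> Rbar_le rho (CV_radius v) ->
  Rbar_le rho (CV_radius (fun n => a * u n + b * v n)).
Proof.
  intros Hrho Hu Hv. apply CV_radius_ge_of_disk; [assumption|]. intros y Hy.
  change (CV_disk (PS_plus (PS_scal a u) (PS_scal b v)) y).
  apply CV_disk_plus; apply CV_disk_scal, CV_disk_inside.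
  - eapply Rbar_lt_le_trans; [|exact Hu]. simpl. rewrite Rabs_pos_eq; lra.
  - eapply Rbar_lt_le_trans; [|exact Hv]. simpl. rewrite Rabs_pos_eq; lra.
Qed.

Lemma CV_radius_acoef (s : R) : Rbar_le (4 / 27) (CV_radius (acoef s)).
Proof.
  erewrite (CV_radius_ext (acoef s)); [|intros n; unfold acoef, Rminus at 1;
    rewrite Ropp_mult_distr_l; reflexivity].
  apply CV_radius_ge_lin; [lra| |]; apply CV_radius_dcoef.
Qed.

(* The sum of [a n z^n x^n] as a function of the real variable [x]: along the ray through [z] a
   complex power series with real coefficients is a pair of real power series. *)
Definition ray_sum (a : nat -> R) (z : C) (x : R) : C :=
  (PSeries (fun n => a n * Re (Cpow z n)) x, PSeries (fun n => a n * Im (Cpow z n)) x).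

Lemma CV_disk_le_coef (a b : nat -> R) (y w : R) :
  (forall n, Rabs (b n * y ^ n) <= Rabs (a n * w ^ n)) -> CV_disk a w -> CV_disk b y.
Proof.
  intros H Ha. unfold CV_disk in *.
  apply (ex_series_le (K := R_AbsRing) (V := R_CompleteNormedModule) _
    (fun n => Rabs (a n * w ^ n))); [|exact Ha].
  intros n. unfold norm. simpl. unfold abs. simpl. now rewrite Rabs_Rabsolu.
Qed.

Lemma Im_le_Cmod (z : C) : Rabs (Im z) <= Cmod z.
Proof. eapply Rle_trans; [apply Rmax_r|apply Rmax_Cmod]. Qed.

Lemma CV_radius_ray (a c : nat -> R) (z : C) (x rho : R) :
  (forall n, Rabs (c n) <= Cmod (Cpow z n)) ->
  Rbar_le rho (CV_radius a) -> Cmod z * Rabs x < rho ->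
  Rbar_lt (Rabs x) (CV_radius (fun n => a n * c n)).
Proof.
  intros Hc Ha Hx.
  assert (Hz := Cmod_ge_0 z). assert (Hx0 := Rabs_pos x).
  (* The strict inequality needs room to the right of |x|: [e] is small enough that |z| (|x| + e)
     stays below rho, and the + 1 covers z = 0. *)
  set (e := (rho - Cmod z * Rabs x) / (Cmod z + 1)).
  assert (He : 0 < e) by (apply Rdiv_lt_0_compat; lra).
  assert (Hy : Cmod z * (Rabs x + e) < rho).
  { assert (e * (Cmod z + 1) = rho - Cmod z * Rabs x) by (unfold e; field; lra). lra. }
  apply Rbar_lt_le_trans with (Rabs x + e); [simpl; lra|].
  destruct (Lub_Rbar_correct (CV_disk (fun n => a n * c n))) as [Hub _]. apply Hub.
  apply CV_disk_le_coef with a (Cmod z * (Rabs x + e)).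
  - intros n. rewrite Rpow_mult_distr, !Rabs_mult, Rmult_assoc.
    apply Rmult_le_compat_l; [apply Rabs_pos|].
    apply Rmult_le_compat_r; [apply Rabs_pos|].
    rewrite <- Cmod_pow, (Rabs_pos_eq (Cmod _)) by apply Cmod_ge_0. apply Hc.
  - apply CV_disk_inside. eapply Rbar_lt_le_trans; [|exact Ha].
    simpl. rewrite Rabs_pos_eq; [assumption|]. apply Rmult_le_pos; lra.
Qed.

Lemma CV_radius_ray_Re (a : nat -> R) (z : C) (x rho : R) :
  Rbar_le rho (CV_radius a) -> Cmod z * Rabs x < rho ->
  Rbar_lt (Rabs x) (CV_radius (fun n => a n * Re (Cpow z n))).
Proof. apply CV_radius_ray. intros n. apply re_le_Cmod. Qed.

Lemma CV_radius_ray_Im (a : nat -> R) (z : C) (x rho : R) :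
  Rbar_le rho (CV_radius a) -> Cmod z * Rabs x < rho ->
  Rbar_lt (Rabs x) (CV_radius (fun n => a n * Im (Cpow z n))).
Proof. apply CV_radius_ray. intros n. apply Im_le_Cmod. Qed.

Lemma ray_sum_ext (a b : nat -> R) (z : C) (x : R) :
  (forall n, a n = b n) -> ray_sum a z x = ray_sum b z x.
Proof. intros H. unfold ray_sum. f_equal; apply PSeries_ext; intros n; now rewrite H. Qed.

Lemma ray_sum_lin (a b : nat -> R) (k l : R) (z : C) (x rho : R) :
  Rbar_le rho (CV_radius a) -> Rbar_le rho (CV_radius b) -> Cmod z * Rabs x < rho ->
  ray_sum (fun n => k * a n + l * b n) z x
  = (RtoC k * ray_sum a z x + RtoC l * ray_sum b z x)%C.
Proof.
  intros Ha Hb Hx.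
  assert (H : forall c : nat -> R, (forall n, Rabs (c n) <= Cmod (Cpow z n)) ->
    PSeries (fun n => (k * a n + l * b n) * c n) x
    = k * PSeries (fun n => a n * c n) x + l * PSeries (fun n => b n * c n) x).
  { intros c Hc. rewrite <- !PSeries_scal, <- PSeries_plus.
    - apply PSeries_ext. intros n. unfold PS_plus, PS_scal, plus, scal, mult.
      simpl. unfold mult. simpl. ring.
    - apply ex_pseries_scal; [apply Rmult_comm|].
      apply CV_radius_inside, CV_radius_ray with z rho; assumption.
    - apply ex_pseries_scal; [apply Rmult_comm|].
      apply CV_radius_inside, CV_radius_ray with z rho; assumption. }
  unfold ray_sum.
  rewrite !H by (intros n; first [apply re_le_Cmod | apply Im_le_Cmod]).
  unfold Cmult, Cplus, RtoC. simpl. f_equal; ring.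
Qed.

Lemma ray_sum_mult (a b : nat -> R) (z : C) (x rho : R) :
  Rbar_le rho (CV_radius a) -> Rbar_le rho (CV_radius b) -> Cmod z * Rabs x < rho ->
  ray_sum (PS_mult a b) z x = (ray_sum a z x * ray_sum b z x)%C.
Proof.
  intros Ha Hb Hx.
  assert (Hpow : forall n k, (k <= n)%nat -> Cpow z n = (Cpow z k * Cpow z (n - k))%C).
  { intros n k Hk. rewrite <- Cpow_add_r. now replace (k + (n - k))%nat with n by lia. }
  assert (Ra := CV_radius_ray_Re _ _ _ _ Ha Hx).
  assert (Ia := CV_radius_ray_Im _ _ _ _ Ha Hx).
  assert (Rb := CV_radius_ray_Re _ _ _ _ Hb Hx).
  assert (Ib := CV_radius_ray_Im _ _ _ _ Hb Hx).
  unfold ray_sum, Cmult. simpl. rewrite <- !PSeries_mult by assumption.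
  rewrite <- PSeries_minus, <- PSeries_plus by (apply ex_pseries_mult; assumption).
  f_equal; apply PSeries_ext; intros n;
    unfold PS_minus, PS_plus, PS_opp, PS_mult, plus, opp; simpl.
  - rewrite (Rmult_comm (sum_f_R0 _ n)), scal_sum.
    match goal with |- _ = sum_f_R0 ?u n + - sum_f_R0 ?v n =>
      change (sum_f_R0 u n + - sum_f_R0 v n) with (sum_f_R0 u n - sum_f_R0 v n) end.
    rewrite <- minus_sum. apply sum_eq. intros k Hk.
    rewrite (Hpow n k Hk). unfold Cmult, Re, Im. simpl. ring.
  - rewrite (Rmult_comm (sum_f_R0 _ n)), scal_sum, <- plus_sum. apply sum_eq. intros k Hk.
    rewrite (Hpow n k Hk). unfold Cmult, Re, Im. simpl. ring.
Qed.

Lemma Cmod_mult_Rabs_1 (z : C) (rho : R) : Cmod z < rho -> Cmod z * Rabs 1 < rho.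
Proof. rewrite Rabs_R1. lra. Qed.

Lemma ray_sum_incr (a : nat -> R) (z : C) (x rho : R) :
  Rbar_le rho (CV_radius a) -> Cmod z * Rabs x < rho ->
  ray_sum (PS_incr_1 a) z x = (RtoC x * z * ray_sum a z x)%C.
Proof.
  intros Ha Hx.
  assert (Ra := CV_radius_inside _ _ (CV_radius_ray_Re _ _ _ _ Ha Hx)).
  assert (Ia := CV_radius_inside _ _ (CV_radius_ray_Im _ _ _ _ Ha Hx)).
  assert (H : forall c : nat -> R,
    PSeries (fun n => PS_incr_1 a n * c n) x = x * PSeries (fun n => a n * c (S n)) x).
  { intros c. rewrite <- PSeries_incr_1. apply PSeries_ext.
    intros [|n]; simpl; [|reflexivity]. unfold zero. simpl. ring. }
  assert (HL : forall k l,
    PSeries (fun n => k * (a n * Re (Cpow z n)) + l * (a n * Im (Cpow z n))) x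
    = k * PSeries (fun n => a n * Re (Cpow z n)) x
      + l * PSeries (fun n => a n * Im (Cpow z n)) x).
  { intros k l. rewrite <- !PSeries_scal, <- PSeries_plus; [reflexivity| |];
      (apply ex_pseries_scal; [apply Rmult_comm|assumption]). }
  unfold ray_sum. rewrite !H.
  rewrite (PSeries_ext (fun n => a n * Re (Cpow z (S n)))
      (fun n => Re z * (a n * Re (Cpow z n)) + - Im z * (a n * Im (Cpow z n)))).
  - rewrite (PSeries_ext (fun n => a n * Im (Cpow z (S n)))
      (fun n => Im z * (a n * Re (Cpow z n)) + Re z * (a n * Im (Cpow z n)))).
    + rewrite !HL. unfold Cmult, RtoC, Re, Im. simpl. f_equal; ring.
    + intros n. rewrite Cpow_S. unfold Cmult, Re, Im. simpl. ring.
  - intros n. rewrite Cpow_S. unfold Cmult, Re, Im. simpl. ring.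
Qed.

Definition is_derive_RC (f : R -> C) (x : R) (l : C) : Prop :=
  is_derive (fun t => Re (f t)) x (Re l) /\ is_derive (fun t => Im (f t)) x (Im l).

(** The operator x d/dx multiplies the n-th coefficient by n. Giving the value of x l rather than of
    l avoids an index shift, but says nothing about l at x = 0. *)
Lemma ray_sum_derive (a : nat -> R) (z : C) (x rho : R) :
  Rbar_le rho (CV_radius a) -> Cmod z * Rabs x < rho ->
  exists l, is_derive_RC (ray_sum a z) x l
    /\ (RtoC x * l)%C = ray_sum (fun n => INR n * a n) z x.
Proof.
  intros Ha Hx.
  exists (PSeries (PS_derive (fun n => a n * Re (Cpow z n))) x,
          PSeries (PS_derive (fun n => a n * Im (Cpow z n))) x).
  split.
  - split; apply is_derive_PSeries;
      [apply (CV_radius_ray_Re _ _ _ _ Ha Hx)|apply (CV_radius_ray_Im _ _ _ _ Ha Hx)].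
  - assert (H : forall c : nat -> R, PSeries (fun n => INR n * a n * c n) x
      = x * PSeries (PS_derive (fun n => a n * c n)) x).
    { intros c. rewrite PSeries_decr_1_aux by (simpl; ring). f_equal. apply PSeries_ext.
      intros n. unfold PS_decr_1, PS_derive. ring. }
    unfold ray_sum. rewrite !H. unfold Cmult, RtoC. simpl. f_equal; ring.
Qed.

Lemma pow_n_Cpow (z : C) (n : nat) : pow_n (K := C_Ring) z n = Cpow z n.
Proof. induction n as [|n IH]; [reflexivity|]. simpl. now rewrite IH. Qed.

Lemma sum_n_C (u : nat -> C) (n : nat) :
  sum_n (G := C_NormedModule) u n = (sum_n (fun k => Re (u k)) n, sum_n (fun k => Im (u k)) n).
Proof.
  induction n as [|n IH].
  - rewrite !sum_O. now destruct (u O).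
  - rewrite !sum_Sn, IH. reflexivity.
Qed.

Lemma ray_sum_is_pseries (a : nat -> R) (z : C) (rho : R) :
  Rbar_le rho (CV_radius a) -> Cmod z < rho ->
  @is_pseries C_AbsRing C_NormedModule (fun n => RtoC (a n)) z (ray_sum a z 1).
Proof.
  intros Ha Hz. apply Cmod_mult_Rabs_1 in Hz.
  assert (Ra := PSeries_correct _ _ (CV_radius_inside _ _ (CV_radius_ray_Re _ _ _ _ Ha Hz))).
  assert (Ia := PSeries_correct _ _ (CV_radius_inside _ _ (CV_radius_ray_Im _ _ _ _ Ha Hz))).
  apply is_pseries_R in Ra. apply is_pseries_R in Ia.
  assert (Ra' := proj1 (filterlim_locally _ _) Ra). clear Ra.
  assert (Ia' := proj1 (filterlim_locally _ _) Ia). clear Ia.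
  apply filterlim_locally. intros eps.
  generalize (filter_and _ _ (Ra' eps) (Ia' eps)). apply filter_imp. intros n [H1 H2].
  rewrite sum_n_C. split; simpl.
  - erewrite sum_n_ext; [exact H1|]. intros k. simpl.
    change (@pow_n C_AbsRing z k) with (@pow_n C_Ring z k).
    rewrite pow_n_Cpow, pow1. unfold scal. simpl. unfold mult. simpl. unfold Re, Im. ring.
  - erewrite sum_n_ext; [exact H2|]. intros k. simpl.
    change (@pow_n C_AbsRing z k) with (@pow_n C_Ring z k).
    rewrite pow_n_Cpow, pow1. unfold scal. simpl. unfold mult. simpl. unfold Re, Im. ring.
Qed.

Lemma ray_sum_scal (k : R) (a : nat -> R) (z : C) (x : R) :
  ray_sum (fun n => k * a n) z x = (RtoC k * ray_sum a z x)%C.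
Proof.
  assert (H : forall c : nat -> R, PSeries (fun n => k * a n * c n) x
    = k * PSeries (fun n => a n * c n) x).
  { intros c. rewrite <- PSeries_scal. apply PSeries_ext. intros n. apply Rmult_assoc. }
  unfold ray_sum. rewrite !H. unfold Cmult, RtoC. simpl. f_equal; ring.
Qed.

Lemma ray_sum_const (a : nat -> R) (z : C) (x rho : R) :
  Rbar_le rho (CV_radius a) -> Cmod z * Rabs x < rho ->
  (forall n, a (S n) = 0) -> ray_sum a z x = a O.
Proof.
  intros Ha Hx H.
  assert (Ra := CV_radius_inside _ _ (CV_radius_ray_Re _ _ _ _ Ha Hx)).
  assert (Ia := CV_radius_inside _ _ (CV_radius_ray_Im _ _ _ _ Ha Hx)).
  unfold ray_sum. rewrite (PSeries_decr_1 _ _ Ra), (PSeries_decr_1 _ _ Ia).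
  rewrite !(PSeries_ext (PS_decr_1 _) (fun _ => 0)), PSeries_const_0
    by (intros n; unfold PS_decr_1; rewrite H; ring).
  unfold RtoC, Re, Im. simpl. f_equal; ring.
Qed.

Lemma ray_sum_at_0 (a : nat -> R) (z : C) : ray_sum a z 0 = a O.
Proof. unfold ray_sum. rewrite !PSeries_0. unfold RtoC, Re, Im. simpl. f_equal; ring. Qed.

(** * The sums of D_r and A_s along a ray *)

Definition Dray (r : R) (z : C) (x : R) : C := ray_sum (dcoef r) z x.
Definition Aray (s : R) (z : C) (x : R) : C := ray_sum (acoef s) z x.

Lemma Aray_mult (r s : R) (z : C) (x : R) : Cmod z * Rabs x < 4 / 27 ->
  (Aray r z x * Aray s z x = Aray (r + s) z x)%C.
Proof.
  intros Hx. unfold Aray.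
  rewrite <- (ray_sum_mult _ _ _ _ _ (CV_radius_acoef r) (CV_radius_acoef s) Hx).
  apply ray_sum_ext. intros n. apply acoef_conv.
Qed.

Lemma Dray_mult (r s : R) (z : C) (x : R) : Cmod z * Rabs x < 4 / 27 ->
  (Dray r z x * Aray s z x = Dray (r + s) z x)%C.
Proof.
  intros Hx. unfold Aray, Dray.
  rewrite <- (ray_sum_mult _ _ _ _ _ (CV_radius_dcoef r) (CV_radius_acoef s) Hx).
  apply ray_sum_ext. intros n. apply dcoef_acoef_conv.
Qed.

Lemma Aray_0 (z : C) (x : R) : Cmod z * Rabs x < 4 / 27 -> Aray 0 z x = 1%C.
Proof.
  intros Hx. unfold Aray.
  rewrite (ray_sum_const _ _ _ _ (CV_radius_acoef 0) Hx acoef_zero_S).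
  now rewrite acoef_0.
Qed.

Lemma Aray_Dray (s : R) (z : C) (x : R) : Cmod z * Rabs x < 4 / 27 ->
  (Aray s z x = 3 * Dray (s - 1) z x - 2 * Dray s z x)%C.
Proof.
  intros Hx. unfold Aray, Dray.
  rewrite (ray_sum_ext _ (fun n => 3 * dcoef (s - 1) n + - (2) * dcoef s n))
    by (intros n; unfold acoef; ring).
  rewrite (ray_sum_lin _ _ _ _ _ _ _ (CV_radius_dcoef (s - 1)) (CV_radius_dcoef s) Hx).
  rewrite RtoC_opp. ring.
Qed.

Lemma Aray_diff (s : R) (z : C) (x : R) : Cmod z * Rabs x < 4 / 27 ->
  (Aray s z x - Aray (s - 1) z x = RtoC x * z * Aray (s + 2) z x)%C.
Proof.
  intros Hx. unfold Aray.
  rewrite <- (ray_sum_incr _ _ _ _ (CV_radius_acoef (s + 2)) Hx).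
  rewrite (ray_sum_ext (PS_incr_1 _) (fun n => 1 * acoef s n + - (1) * acoef (s - 1) n)).
  - rewrite (ray_sum_lin _ _ _ _ _ _ _ (CV_radius_acoef s) (CV_radius_acoef (s - 1)) Hx).
    rewrite RtoC_opp. ring.
  - intros [|n]; simpl PS_incr_1.
    + rewrite !acoef_0. unfold zero. simpl. ring.
    + rewrite <- acoef_diff. ring.
Qed.

(** Writing D_s as D_0 A_s makes the logarithmic derivative of A_s equal to s times a quantity free
    of s. This is what allows the exponents r and 1 to be compared. *)
Lemma Aray_derive (s : R) (z : C) (x : R) : Cmod z * Rabs x < 4 / 27 ->
  exists l, is_derive_RC (Aray s z) x l
    /\ (3 * (RtoC x * l) = s * Aray s z x * (Dray 0 z x - 1))%C.
Proof.
  intros Hx.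
  destruct (ray_sum_derive _ _ _ _ (CV_radius_acoef s) Hx) as (l & Hl & E).
  exists l. split; [exact Hl|]. rewrite E.
  transitivity (ray_sum (fun n => s * dcoef s n + - s * acoef s n) z x).
  - rewrite <- (ray_sum_scal 3). apply ray_sum_ext.
    intros n. generalize (acoef_euler s n). lra.
  - rewrite (ray_sum_lin _ _ _ _ _ _ _ (CV_radius_dcoef s) (CV_radius_acoef s) Hx).
    fold (Dray s z x) (Aray s z x).
    replace (Dray s z x) with (Dray 0 z x * Aray s z x)%C
      by (rewrite Dray_mult, Rplus_0_l by assumption; reflexivity).
    rewrite RtoC_opp. ring.
Qed.

(** * Complex elementary functions *)

Lemma Cmod_sqr (z : C) : Cmod z * Cmod z = Re z * Re z + Im z * Im z.
Proof. generalize (Cmod2_alt z). simpl. intros H. lra. Qed.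

Lemma Cmod_le_Re_Im (z : C) : Cmod z <= Rabs (Re z) + Rabs (Im z).
Proof.
  rewrite <- (Cmod_R (Re z)), <- (Rmult_1_l (Rabs (Im z))), <- Cmod_Ci, <- Cmod_R, <- Cmod_mult.
  eapply Rle_trans; [|apply Cmod_triangle]. right. f_equal.
  destruct z as [a b]. unfold Cplus, Cmult, Ci, RtoC. simpl. f_equal; ring.
Qed.

Lemma Cmod_sub_le (z w : C) : Cmod z - Cmod w <= Cmod (z - w).
Proof.
  assert (H := Cmod_triangle (z - w) w). replace (z - w + w)%C with z in H by ring. lra.
Qed.

Lemma Cmod_minus_le (z w : C) : Cmod (z - w) <= Cmod z + Cmod w.
Proof. unfold Cminus. rewrite <- (Cmod_opp w). apply Cmod_triangle. Qed.

Lemma Cexp_plus (z w : C) : Cexp (z + w) = (Cexp z * Cexp w)%C.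
Proof.
  unfold Cexp, Cmult, Re, Im. simpl.
  rewrite exp_plus, cos_plus, sin_plus. f_equal; ring.
Qed.

Lemma Cexp_0 : Cexp 0 = 1%C.
Proof. unfold Cexp, Re, Im, RtoC. simpl. rewrite exp_0, cos_0, sin_0. f_equal; ring. Qed.

Lemma Cexp_opp (z : C) : (Cexp z * Cexp (- z) = 1)%C.
Proof. rewrite <- Cexp_plus, <- Cexp_0. f_equal. ring. Qed.

Lemma Cexp_neq_0 (z : C) : Cexp z <> 0%C.
Proof.
  intros H. apply C1_nz. rewrite <- (Cexp_opp z), H. ring.
Qed.

Lemma cos_sin_2atan (x : R) :
  cos (2 * atan x) = (1 - x * x) / (1 + x * x) /\ sin (2 * atan x) = 2 * x / (1 + x * x).
Proof.
  assert (Hc : 0 < cos (atan x)).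
  { destruct (atan_bound x). apply cos_gt_0; lra. }
  assert (Ht : sin (atan x) = x * cos (atan x)).
  { rewrite <- (tan_atan x) at 2. unfold tan. field. lra. }
  assert (H1 := sin2_cos2 (atan x)). unfold Rsqr in H1. rewrite Ht in H1.
  assert (Hx : 0 < 1 + x * x) by nra.
  assert (H2 : cos (atan x) * cos (atan x) = / (1 + x * x)).
  { apply Rmult_eq_reg_r with (1 + x * x); [|lra]. rewrite Rinv_l by lra. lra. }
  split.
  - rewrite cos_2a, Ht.
    replace (cos (atan x) * cos (atan x) - x * cos (atan x) * (x * cos (atan x)))
      with ((1 - x * x) * (cos (atan x) * cos (atan x))) by ring.
    now rewrite H2.
  - rewrite sin_2a, Ht.
    replace (2 * (x * cos (atan x)) * cos (atan x))
      with (2 * x * (cos (atan x) * cos (atan x))) by ring.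
    now rewrite H2.
Qed.

Lemma Cexp_Clog (w : C) : 0 < Re w -> Cexp (Clog w) = w.
Proof.
  intros Hw. assert (Hm := Cmod_sqr w). assert (Hm0 := Cmod_ge_0 w).
  assert (Hp : 0 < Cmod w) by nra.
  unfold Cexp, Clog, Carg. simpl. destruct Rlt_dec as [H|H]; [|lra].
  set (m := Cmod w) in *. destruct w as [a b]. simpl in *.
  destruct (cos_sin_2atan (b / (m + a))) as [-> ->]. rewrite exp_ln by assumption.
  (* Follows from m^2 = a^2 + b^2. Divided by (m + a)^2 it is the denominator 1 + tan^2 of the
     half-angle formulas. *)
  assert (Hd : (m + a) * (m + a) + b * b = 2 * m * (m + a)) by nra.
  assert (Hq : 1 + b / (m + a) * (b / (m + a)) = 2 * m / (m + a)).
  { apply Rmult_eq_reg_r with ((m + a) * (m + a)); [|nra]. field_simplify; [|lra|lra]. nra. }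
  rewrite Hq. f_equal.
  - transitivity (((m + a) * (m + a) - b * b) / (2 * (m + a))); [field; lra|].
    replace ((m + a) * (m + a) - b * b) with (a * (2 * (m + a))) by nra. field. lra.
  - field. lra.
Qed.

Lemma Rabs_Carg_lt (w : C) : 0 < Re w -> Rabs (Carg w) < PI / 2.
Proof.
  intros Hw. assert (Hm := Cmod_sqr w). assert (Hm0 := Cmod_ge_0 w).
  unfold Carg. destruct Rlt_dec as [H|H]; [|lra].
  (* As |Im w| <= |w| < |w| + Re w, the tangent of half the argument lies in (-1, 1), and the
     half-argument within PI/4 of 0. *)
  assert (Hb : - (1) < Im w / (Cmod w + Re w) < 1).
  { assert (- Cmod w <= Im w <= Cmod w) by (apply Rabs_le_between, Im_le_Cmod).
    split; apply Rmult_lt_reg_r with (Cmod w + Re w); try assumption;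
      unfold Rdiv; rewrite Rmult_assoc, Rinv_l; lra. }
  destruct Hb as [Hb1 Hb2]. apply atan_increasing in Hb1, Hb2.
  rewrite atan_opp, atan_1 in Hb1. rewrite atan_1 in Hb2.
  apply Rabs_lt_between. lra.
Qed.

Lemma Csqrt_sqr (w : C) : (Csqrt w * Csqrt w = w)%C.
Proof.
  assert (Hr := re_le_Cmod w). apply Rabs_le_between in Hr.
  assert (Hm := Cmod_sqr w).
  assert (H1 := sqrt_sqrt ((Cmod w + Re w) / 2) ltac:(lra)).
  assert (H2 := sqrt_sqrt ((Cmod w - Re w) / 2) ltac:(lra)).
  assert (H3 : sqrt ((Cmod w + Re w) / 2) * sqrt ((Cmod w - Re w) / 2) = Rabs (Im w) / 2).
  { rewrite <- sqrt_mult by lra.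
    replace ((Cmod w + Re w) / 2 * ((Cmod w - Re w) / 2)) with (Rsqr (Im w / 2))
      by (unfold Rsqr; lra).
    rewrite sqrt_Rsqr_abs. unfold Rdiv. rewrite Rabs_mult, (Rabs_pos_eq (/ 2)) by lra. ring. }
  destruct w as [a b]. unfold Csqrt, Cmult. cbn [Re Im fst snd] in *.
  set (p := sqrt ((Cmod (a, b) + a) / 2)) in *.
  set (q := sqrt ((Cmod (a, b) - a) / 2)) in *.
  destruct Rle_dec as [Hb|Hb].
  - rewrite Rabs_pos_eq in H3 by assumption. f_equal; nra.
  - rewrite Rabs_left in H3 by lra. f_equal; nra.
Qed.

(* On the unit disc, [(Im u)^2 < 1 - (Re u)^2 <= (Re (sqrt (1 - u^2)))^2]. *)
Lemma Re_arcsin_arg_pos (u : C) : Cmod u < 1 -> 0 < Re (Ci * u + Csqrt (1 - u * u))%C.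
Proof.
  intros Hu. assert (Hm := Cmod_sqr u). assert (Hm0 := Cmod_ge_0 u).
  assert (H1 : Cmod u * Cmod u < 1) by nra.
  assert (Hs : 1 - Cmod u * Cmod u <= Cmod (1 - u * u)).
  { generalize (Cmod_sub_le 1 (u * u)). rewrite Cmod_1, Cmod_mult. lra. }
  assert (Hre : Re (1 - u * u)%C = 1 - Re u * Re u + Im u * Im u).
  { destruct u. unfold Cminus, Cplus, Copp, Cmult, RtoC. simpl. ring. }
  set (p := (Cmod (1 - u * u) + Re (1 - u * u)%C) / 2).
  assert (Hp : Im u * Im u < p) by (unfold p; rewrite Hre; lra).
  replace (Re (Ci * u + Csqrt (1 - u * u))%C) with (sqrt p - Im u)
    by (destruct u; unfold p, Csqrt, Cplus, Cmult, Ci; simpl; ring).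
  assert (H := sqrt_pos p). assert (H' := sqrt_sqrt p ltac:(nra)). nra.
Qed.

(** Here w plays the role of exp (i arcsin u), and the identity is w - 1/w = 2 i u multiplied by
    w. *)
Lemma arcsin_arg_eq (u : C) :
  let w := (Ci * u + Csqrt (1 - u * u))%C in (w * w - 2 * Ci * u * w = 1)%C.
Proof.
  intros w. unfold w. generalize (Csqrt_sqr (1 - u * u)).
  set (v := Csqrt (1 - u * u)). intros H.
  assert (Hi : (Ci * Ci = - (1))%C) by (unfold Cmult, Ci, Copp, RtoC; simpl; f_equal; ring).
  replace ((Ci * u + v) * (Ci * u + v) - 2 * Ci * u * (Ci * u + v))%C
    with (v * v - Ci * Ci * (u * u))%C by ring.
  rewrite H, Hi. ring.
Qed.

(** * The cubic [t (1 - t)^2 = z] *)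

(** Since |1 - t|^2 = 1 - 2 Re t + |t|^2 >= 1/3 + 1/9 = 4/9, multiplying by |t| >= 1/3 gives 4/27,
    with equality at the critical point t = 1/3. *)
Lemma cubic_lower_bound (t : C) : Re t <= 1 / 3 -> 1 / 3 <= Cmod t ->
  4 / 27 <= Cmod (t * ((1 - t) * (1 - t)))%C.
Proof.
  intros Hr Ht. rewrite !Cmod_mult, Cmod_sqr. assert (Hm := Cmod_sqr t).
  replace (Re (1 - t)%C * Re (1 - t)%C + Im (1 - t)%C * Im (1 - t)%C)
    with (1 - 2 * Re t + (Re t * Re t + Im t * Im t))
    by (destruct t; unfold Cminus, Cplus, Copp, RtoC; simpl; ring).
  rewrite <- Hm. nra.
Qed.

Lemma cubic_diff_factor (a b : C) :
  (a * ((1 - a) * (1 - a)) - b * ((1 - b) * (1 - b))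
   = (a - b) * ((1 - a - b) * (1 - a - b) - a * b))%C.
Proof. ring. Qed.

(** With |b| < 1/3 the factor is at least (2/3 - |a|)^2 - |a|/3, which factors as on the left. The
    bound depends on [a] alone, so it serves both for injectivity and, with [a] fixed, as a
    Lipschitz estimate. *)
Lemma cubic_factor_lower (a b : C) : Cmod a < 1 / 3 -> Cmod b < 1 / 3 ->
  (1 / 3 - Cmod a) * (4 / 3 - Cmod a) <= Cmod ((1 - a - b) * (1 - a - b) - a * b)%C.
Proof.
  intros Ha Hb. assert (Ha0 := Cmod_ge_0 a). assert (Hb0 := Cmod_ge_0 b).
  eapply Rle_trans; [|apply Cmod_sub_le]. rewrite !Cmod_mult.
  assert (1 - Cmod a - Cmod b <= Cmod (1 - a - b)).
  { generalize (Cmod_sub_le (1 - a) b) (Cmod_sub_le 1 a). rewrite Cmod_1. lra. }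
  nra.
Qed.

Lemma cubic_inj (a b : C) : Cmod a < 1 / 3 -> Cmod b < 1 / 3 ->
  (a * ((1 - a) * (1 - a)) = b * ((1 - b) * (1 - b)))%C -> a = b.
Proof.
  intros Ha Hb E. assert (H := cubic_diff_factor a b). rewrite E in H.
  assert (H0 := cubic_factor_lower a b Ha Hb).
  apply (f_equal Cmod) in H. rewrite Cmod_mult in H.
  match type of H with Cmod ?u = _ => replace u with (RtoC 0) in H by ring end.
  rewrite Cmod_0 in H. symmetry in H. apply Rmult_integral in H.
  destruct H as [H|H]; [|nra].
  apply Cmod_eq_0 in H. replace a with (a - b + b)%C by ring. rewrite H. ring.
Qed.

(** * The sine of a third of the arcsine *)

Lemma Ci_sqr : (Ci * Ci = - (1))%C.
Proof. unfold Cmult, Ci, Copp, RtoC. simpl. f_equal; ring. Qed.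

Lemma Ci_neq_0 : Ci <> 0%C.
Proof. intros H. injection H. lra. Qed.

Lemma RtoC_neq_0 (x : R) : x <> 0 -> RtoC x <> 0%C.
Proof. intros H E. apply H. now apply RtoC_inj. Qed.

Lemma Csin_sqr (a : C) :
  (Csin a * Csin a = - ((Cexp (Ci * a) - Cexp (- (Ci * a))) ^ 2) / 4)%C.
Proof.
  unfold Csin. set (d := (Cexp (Ci * a) - Cexp (- (Ci * a)))%C).
  transitivity (d ^ 2 / (4 * (Ci * Ci)))%C; [field; exact Ci_neq_0|].
  rewrite Ci_sqr. field.
Qed.

Lemma Ccos_sqr_plus_Csin_sqr (a : C) : (Ccos a * Ccos a + Csin a * Csin a = 1)%C.
Proof.
  rewrite Csin_sqr. unfold Ccos. generalize (Cexp_opp (Ci * a)).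
  set (e := Cexp (Ci * a)). set (f := Cexp (- (Ci * a))). intros H.
  transitivity (e * f)%C; [field|exact H].
Qed.

Lemma Ci_Carcsin_third (u : C) :
  (Ci * (Carcsin u / 3) = Clog (Ci * u + Csqrt (1 - u * u)) / 3)%C.
Proof.
  unfold Carcsin. set (l := Clog _).
  transitivity (- (Ci * Ci) * l / 3)%C; [field|].
  rewrite Ci_sqr. field.
Qed.

(* The triple-angle formula [sin (3 a) = 3 sin a - 4 sin^3 a], squared. *)
Lemma arcsin_third_cubic (u : C) : Cmod u < 1 ->
  let t := (4 / 3 * (Csin (Carcsin u / 3) * Csin (Carcsin u / 3)))%C in
  (t * ((1 - t) * (1 - t)) = 4 * (u * u) / 27)%C.
Proof.
  intros Hu t. unfold t. clear t. rewrite Csin_sqr, Ci_Carcsin_third.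
  generalize (Cexp_Clog _ (Re_arcsin_arg_pos u Hu)) (arcsin_arg_eq u). simpl.
  set (w := (Ci * u + Csqrt (1 - u * u))%C). intros Hw Hq.
  set (e := Cexp (Clog w / 3)). set (f := Cexp (- (Clog w / 3))).
  assert (Hef : (e * f = 1)%C) by apply Cexp_opp.
  assert (He : (e ^ 3 = w)%C).
  { rewrite <- Hw. unfold e. transitivity (Cexp (Clog w / 3 + Clog w / 3 + Clog w / 3)).
    - rewrite !Cexp_plus. ring.
    - f_equal. field. }
  assert (Hf : (w * f ^ 3 = 1)%C).
  { rewrite <- He. transitivity ((e * f) ^ 3)%C; [ring|]. rewrite Hef. ring. }
  assert (Hwf : (w - f ^ 3 = 2 * Ci * u)%C).
  { transitivity (w * (w * f ^ 3) - f ^ 3)%C; [rewrite Hf; ring|].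
    transitivity (f ^ 3 * (w * w - 1))%C; [ring|]. rewrite <- Hq.
    transitivity (2 * Ci * u * (w * f ^ 3))%C; [ring|]. rewrite Hf. ring. }
  (* Here t = - (e - f)^2 / 3, and e f = 1 gives 1 - t = (3 e f + (e - f)^2) / 3. The product (e -
     f) (3 e f + (e - f)^2) collapses to e^3 - f^3. *)
  transitivity (- ((e - f) * (3 * (e * f) + (e - f) ^ 2)) ^ 2 / 27)%C.
  { rewrite Hef. field. }
  transitivity (- (e ^ 3 - f ^ 3) ^ 2 / 27)%C; [field|].
  rewrite He, Hwf. transitivity (- (Ci * Ci) * 4 * (u * u) / 27)%C; [field|].
  rewrite Ci_sqr. field.
Qed.

(** The real part is (2 - (exp p + exp (-p)) cos q) / 3 with q two thirds of the argument of w. That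
    argument is below PI/2 in absolute value, so |q| < PI/3 and cos q > 1/2, while exp p + exp (-p)
    >= 2. *)
Lemma Re_arcsin_third_lt (u : C) : Cmod u < 1 ->
  Re (4 / 3 * (Csin (Carcsin u / 3) * Csin (Carcsin u / 3)))%C < 1 / 3.
Proof.
  intros Hu. rewrite Csin_sqr, Ci_Carcsin_third.
  generalize (Rabs_Carg_lt _ (Re_arcsin_arg_pos u Hu)).
  set (w := (Ci * u + Csqrt (1 - u * u))%C). intros Hw.
  set (p := ln (Cmod w) * 2 / 3). set (q := Carg w * 2 / 3).
  assert (Hpq : (2 * (Clog w / 3))%C = (p, q)).
  { unfold Clog, p, q. transitivity (RtoC (2 / 3) * (ln (Cmod w), Carg w))%C.
    - rewrite RtoC_div by lra. field.
    - unfold Cmult, RtoC. simpl. f_equal; field. }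
  assert (E : (4 / 3 * (- (Cexp (Clog w / 3) - Cexp (- (Clog w / 3))) ^ 2 / 4))%C
            = (RtoC (1 / 3) * (2 - Cexp (p, q) - Cexp (- (p, q))))%C).
  { rewrite <- Hpq. rewrite RtoC_div by lra.
    replace (- (2 * (Clog w / 3)))%C with (- (Clog w / 3) + - (Clog w / 3))%C by ring.
    replace (2 * (Clog w / 3))%C with (Clog w / 3 + Clog w / 3)%C by ring.
    rewrite !Cexp_plus. generalize (Cexp_opp (Clog w / 3)).
    set (e := Cexp (Clog w / 3)). set (f := Cexp (- (Clog w / 3))). intros Hef.
    transitivity (1 / 3 * (2 * (e * f) - e * e - f * f))%C; [field|].
    rewrite Hef. ring. }
  rewrite E.
  assert (Hcos : 1 / 2 < cos q).
  { apply Rabs_lt_between in Hw. rewrite <- cos_PI3. assert (HPI := PI_RGT_0).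
    destruct (Rle_dec 0 q).
    - apply cos_decreasing_1; unfold q in *; lra.
    - rewrite <- (cos_neg q). apply cos_decreasing_1; unfold q in *; lra. }
  assert (Hexp : 2 <= exp p + exp (- p)).
  { assert (H1 := exp_pos p). assert (H2 : exp p * exp (- p) = 1)
      by (rewrite <- exp_plus, Rplus_opp_r; apply exp_0).
    assert (H0 := exp_pos (- p)).
    assert (0 <= (exp p - exp (- p)) * (exp p - exp (- p))) by apply Rle_0_sqr. nra. }
  unfold Cexp, Cminus, Cmult, Cplus, Copp, RtoC, Re, Im. simpl. rewrite cos_neg. nra.
Qed.

Lemma arcsin_third_small (u : C) : Cmod u < 1 ->
  Cmod (4 / 3 * (Csin (Carcsin u / 3) * Csin (Carcsin u / 3)))%C < 1 / 3.
Proof.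
  intros Hu. apply Rnot_le_lt. intros H.
  apply cubic_lower_bound in H; [|left; now apply Re_arcsin_third_lt].
  rewrite (arcsin_third_cubic u Hu) in H.
  rewrite Cmod_div, !Cmod_mult, !Cmod_R, !Rabs_pos_eq in H
    by first [lra | apply RtoC_neq_0; lra].
  generalize (Cmod_ge_0 u). nra.
Qed.

(** * Complex derivatives *)

Lemma is_derive_C_eps (f : C -> C) (z l : C) :
  @is_derive C_AbsRing C_NormedModule f z l <->
  forall eps, 0 < eps -> exists delta, 0 < delta /\ forall y, Cmod (y - z) < delta ->
    Cmod (f y - f z - (y - z) * l) <= eps * Cmod (y - z).
Proof.
  split.
  - intros [_ H] eps Heps.
    specialize (H z (fun P h => h) (mkposreal eps Heps)).
    destruct H as [d Hd]. exists d. split; [apply cond_pos|].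
    intros y Hy. exact (Hd y Hy).
  - intros H. split; [apply is_linear_scal_l|].
    intros x Hx.
    rewrite <- (@is_filter_lim_locally_unique _ (AbsRing_NormedModule C_AbsRing) z x Hx).
    clear x Hx.
    intros eps. destruct (H eps (cond_pos eps)) as (d & Hd & Hy).
    exists (mkposreal d Hd). intros y Hyd. exact (Hy y Hyd).
Qed.

(** Implicit differentiation of F (g y) = h y for a [g] known only to be continuous at z. It serves
    twice: for the root t, with F the cubic, and for the logarithm of the base, with F an
    exponential. *)
Lemma is_derive_C_implicit (F g h : C -> C) (z F' h' : C) (r : R) :
  0 < r -> (forall y, Cmod (y - z) < r -> F (g y) = h y) ->
  (forall eps, 0 < eps -> exists delta, 0 < delta /\
    forall y, Cmod (y - z) < delta -> Cmod (g y - g z) < eps) ->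
  @is_derive C_AbsRing C_NormedModule F (g z) F' -> F' <> 0%C ->
  @is_derive C_AbsRing C_NormedModule h z h' ->
  @is_derive C_AbsRing C_NormedModule g z (h' / F')%C.
Proof.
  intros Hr HF Hg HF' Hne Hh.
  assert (Hk : 0 < Cmod F') by now apply Cmod_gt_0.
  set (k := Cmod F') in *. set (m := Cmod h').
  assert (Hm : 0 <= m) by apply Cmod_ge_0.
  apply is_derive_C_eps. intros eps Heps.
  set (K := 2 * (m + 1) / k).
  assert (HK : 0 < K) by (apply Rdiv_lt_0_compat; lra).
  (* The bounds k / 2 and 1 let the error in |a| be absorbed on the left, which yields |a| <= K |b|.
     The other two bounds then make each remainder at most eps k / 2 times |b|. *)
  set (e1 := Rmin (k / 2) (eps * k / (2 * K))).
  set (e2 := Rmin 1 (eps * k / 2)).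
  assert (He1 : 0 < e1).
  { unfold e1. apply Rmin_pos; [lra|]. apply Rdiv_lt_0_compat; [|lra].
    now apply Rmult_lt_0_compat. }
  assert (He2 : 0 < e2) by (unfold e2; apply Rmin_pos; [lra|]; nra).
  destruct (proj1 (is_derive_C_eps _ _ _) HF' e1 He1) as (d1 & Hd1 & H1).
  destruct (proj1 (is_derive_C_eps _ _ _) Hh e2 He2) as (d2 & Hd2 & H2).
  destruct (Hg d1 Hd1) as (d3 & Hd3 & H3).
  exists (Rmin r (Rmin d2 d3)). split; [repeat apply Rmin_pos; assumption|].
  intros y Hy.
  assert (Hyr := Rlt_le_trans _ _ _ Hy (Rmin_l _ _)).
  assert (Hy' := Rlt_le_trans _ _ _ Hy (Rmin_r _ _)).
  specialize (H2 y (Rlt_le_trans _ _ _ Hy' (Rmin_l _ _))).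
  specialize (H3 y (Rlt_le_trans _ _ _ Hy' (Rmin_r _ _))).
  specialize (H1 (g y) H3).
  rewrite !HF in H1 by (try assumption; replace (z - z)%C with (RtoC 0) by ring;
    rewrite Cmod_0; assumption).
  set (a := (g y - g z)%C) in *. set (b := (y - z)%C) in *.
  set (E1 := (h y - h z - a * F')%C) in *. set (E2 := (h y - h z - b * h')%C) in *.
  assert (Ha0 := Cmod_ge_0 a). assert (Hb0 := Cmod_ge_0 b).
  assert (e1 <= k / 2) by apply Rmin_l. assert (e2 <= 1) by apply Rmin_l.
  assert (HaF : (a * F' = b * h' + E2 - E1)%C) by (unfold E1, E2; ring).
  assert (Hak : Cmod a * k <= Cmod b * m + e2 * Cmod b + e1 * Cmod a).
  { unfold k. rewrite <- Cmod_mult, HaF.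
    generalize (Cmod_minus_le (b * h' + E2) E1) (Cmod_triangle (b * h') E2).
    rewrite Cmod_mult. fold m. lra. }
  assert (HaK : Cmod a <= K * Cmod b).
  { apply Rmult_le_reg_r with (k / 2); [lra|].
    replace (K * Cmod b * (k / 2)) with ((m + 1) * Cmod b) by (unfold K; field; lra). nra. }
  replace (a - b * (h' / F'))%C with ((E2 - E1) / F')%C.
  2:{ transitivity ((a * F' - b * h') / F')%C; [f_equal; rewrite HaF; ring|].
      field; assumption. }
  rewrite Cmod_div by assumption. fold k.
  apply Rmult_le_reg_r with k; [assumption|].
  unfold Rdiv. rewrite Rmult_assoc, Rinv_l by lra.
  generalize (Cmod_minus_le E2 E1).
  assert (Hs1 : e1 * Cmod a <= eps * k / 2 * Cmod b).
  { apply Rle_trans with (eps * k / (2 * K) * (K * Cmod b)).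
    - apply Rmult_le_compat; try lra. apply Rmin_r.
    - right. field. lra. }
  assert (Hs2 : e2 * Cmod b <= eps * k / 2 * Cmod b)
    by (apply Rmult_le_compat_r; [assumption|apply Rmin_r]).
  lra.
Qed.

Lemma derivable_pt_lim_remainder (f : R -> R) (x l eps : R) :
  derivable_pt_lim f x l -> 0 < eps -> exists delta, 0 < delta /\
  forall h, Rabs h < delta -> Rabs (f (x + h) - f x - l * h) <= eps * Rabs h.
Proof.
  intros Hf He. destruct (Hf eps He) as [d Hd].
  exists d. split; [apply cond_pos|]. intros h Hh.
  destruct (Req_dec h 0) as [->|Hne].
  { rewrite Rplus_0_r. replace (f x - f x - l * 0) with 0 by ring. rewrite Rabs_R0. lra. }
  specialize (Hd h Hne Hh).
  replace (f (x + h) - f x - l * h) with (((f (x + h) - f x) / h - l) * h)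
    by (field; assumption).
  rewrite Rabs_mult. apply Rmult_le_compat_r; [apply Rabs_pos|lra].
Qed.

Lemma is_derive_Cexp (z : C) : @is_derive C_AbsRing C_NormedModule Cexp z (Cexp z).
Proof.
  apply is_derive_C_eps. intros eps Heps.
  set (M := Cmod (Cexp z)). assert (HM : 0 <= M) by apply Cmod_ge_0.
  (* The 12 leaves slack over the 1 + 3 + 3 + 2 multiples of e |h| that the first-order expansions
     of exp, sin and cos at 0 contribute. *)
  set (e := Rmin 1 (eps / (M + 1) / 12)).
  assert (He : 0 < e).
  { apply Rmin_pos; [lra|]. repeat apply Rdiv_lt_0_compat; lra. }
  assert (He1 : e <= 1) by apply Rmin_l.
  assert (HeM : e * 12 * M <= eps).
  { assert (e * 12 <= eps / (M + 1)) by (generalize (Rmin_r 1 (eps / (M + 1) / 12)); fold e; lra).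
    apply Rle_trans with (eps / (M + 1) * M); [apply Rmult_le_compat_r; lra|].
    assert (eps / (M + 1) * (M + 1) = eps) by (field; lra).
    assert (0 < eps / (M + 1)) by (apply Rdiv_lt_0_compat; lra). nra. }
  clearbody e.
  destruct (derivable_pt_lim_remainder _ _ _ _ (derivable_pt_lim_exp 0) He) as (d1 & Hd1 & H1).
  destruct (derivable_pt_lim_remainder _ _ _ _ (derivable_pt_lim_sin 0) He) as (d2 & Hd2 & H2).
  destruct (derivable_pt_lim_remainder _ _ _ _ (derivable_pt_lim_cos 0) He) as (d3 & Hd3 & H3).
  exists (Rmin (Rmin e d1) (Rmin d2 d3)). split; [repeat apply Rmin_pos; assumption|].
  intros y Hy. set (h := (y - z)%C) in *.
  replace y with (z + h)%C by (unfold h; ring). rewrite Cexp_plus.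
  replace (Cexp z * Cexp h - Cexp z - h * Cexp z)%C with (Cexp z * (Cexp h - 1 - h))%C by ring.
  rewrite Cmod_mult. fold M.
  assert (Hl := Rlt_le_trans _ _ _ Hy (Rmin_l _ _)).
  assert (Hrr := Rlt_le_trans _ _ _ Hy (Rmin_r _ _)).
  assert (Hle := Rlt_le_trans _ _ _ Hl (Rmin_l _ _)).
  assert (Hl1 := Rlt_le_trans _ _ _ Hl (Rmin_r _ _)).
  assert (Hr2 := Rlt_le_trans _ _ _ Hrr (Rmin_l _ _)).
  assert (Hr3 := Rlt_le_trans _ _ _ Hrr (Rmin_r _ _)).
  clear Hy Hl Hrr. assert (Hh := Cmod_ge_0 h).
  assert (Ha := re_le_Cmod h). assert (Hb := Im_le_Cmod h).
  cut (Cmod (Cexp h - 1 - h) <= 12 * e * Cmod h).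
  { intros H. apply Rle_trans with (M * (12 * e * Cmod h)); [now apply Rmult_le_compat_l|].
    replace (M * (12 * e * Cmod h)) with (e * 12 * M * Cmod h) by ring.
    now apply Rmult_le_compat_r. }
  set (a := Re h) in *. set (b := Im h) in *.
  specialize (H1 a ltac:(lra)). specialize (H2 b ltac:(lra)). specialize (H3 b ltac:(lra)).
  rewrite Rplus_0_l, exp_0, Rmult_1_l in H1.
  rewrite Rplus_0_l, sin_0, cos_0, Rminus_0_r, Rmult_1_l in H2.
  rewrite Rplus_0_l, sin_0, cos_0, Ropp_0, Rmult_0_l, Rminus_0_r in H3.
  assert (Ha0 := Rabs_pos a). assert (Hb0 := Rabs_pos b).
  assert (Hexp1 : Rabs (exp a - 1) <= 2 * Rabs a).
  { replace (exp a - 1) with (exp a - 1 - a + a) by ring.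
    eapply Rle_trans; [apply Rabs_triang|]. nra. }
  assert (Hexp : Rabs (exp a) <= 3).
  { replace (exp a) with (exp a - 1 + 1) by ring.
    eapply Rle_trans; [apply Rabs_triang|]. rewrite Rabs_R1. lra. }
  assert (He0 := Rabs_pos (exp a)).
  eapply Rle_trans; [apply Cmod_le_Re_Im|].
  replace (Re (Cexp h - 1 - h)%C) with ((exp a - 1 - a) + exp a * (cos b - 1))
    by (unfold a, b, Cexp; destruct h; simpl; ring).
  replace (Im (Cexp h - 1 - h)%C) with (exp a * (sin b - b) + (exp a - 1) * b)
    by (unfold a, b, Cexp; destruct h; simpl; ring).
  assert (T1 := Rabs_triang (exp a - 1 - a) (exp a * (cos b - 1))).
  assert (T2 := Rabs_triang (exp a * (sin b - b)) ((exp a - 1) * b)).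
  rewrite Rabs_mult in T1. rewrite !Rabs_mult in T2.
  assert (Rabs (exp a) * Rabs (cos b - 1) <= 3 * (e * Rabs b))
    by (apply Rmult_le_compat; try assumption; apply Rabs_pos).
  assert (Rabs (exp a) * Rabs (sin b - b) <= 3 * (e * Rabs b))
    by (apply Rmult_le_compat; try assumption; apply Rabs_pos).
  assert (Rabs (exp a - 1) * Rabs b <= 2 * Rabs a * Rabs b)
    by (apply Rmult_le_compat_r; assumption).
  assert (Rabs a * Rabs b <= e * Cmod h) by (apply Rmult_le_compat; lra).
  assert (e * Rabs a <= e * Cmod h) by (apply Rmult_le_compat_l; lra).
  assert (e * Rabs b <= e * Cmod h) by (apply Rmult_le_compat_l; lra).
  assert (0 <= e * Cmod h) by (apply Rmult_le_pos; lra).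
  lra.
Qed.

(** This is the continuity input for implicit differentiation, which then supplies the derivative of
    the logarithm from that of the exponential. *)
Lemma continuous_Clog (w : C) : 0 < Re w ->
  @continuous C_UniformSpace C_UniformSpace Clog w.
Proof.
  intros Hw. assert (Hm0 := Cmod_ge_0 w).
  assert (Hp : 0 < Cmod w) by (generalize (re_le_Cmod w) (Rle_abs (Re w)); lra).
  assert (HM : @continuous C_UniformSpace R_UniformSpace Cmod w)
    by exact (@filterlim_norm C_AbsRing C_NormedModule w).
  assert (HR : @continuous C_UniformSpace R_UniformSpace Re w)
    by (destruct w; apply (@continuous_fst R_UniformSpace R_UniformSpace)).
  assert (HI : @continuous C_UniformSpace R_UniformSpace Im w)
    by (destruct w; apply (@continuous_snd R_UniformSpace R_UniformSpace)).
  assert (HS : @continuous C_UniformSpace R_UniformSpace (fun w => Cmod w + Re w) w)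
    by exact (@continuous_plus C_UniformSpace R_AbsRing R_NormedModule _ _ _ HM HR).
  assert (Hln : @continuous C_UniformSpace R_UniformSpace (fun w => ln (Cmod w)) w)
    by (apply (@continuous_comp C_UniformSpace R_UniformSpace R_UniformSpace);
        [exact HM|now apply continuous_ln]).
  assert (Harg : @continuous C_UniformSpace R_UniformSpace Carg w).
  { apply continuous_ext_loc with
      (fun w => mult 2 (atan (mult (Im w) (/ (Cmod w + Re w))))).
    - assert (HL : locally w (fun y : C_UniformSpace => 0 < Cmod y + Re y))
        by (apply (HS (fun y => 0 < y)), (open_gt 0); lra).
      revert HL. apply filter_imp. intros y Hy. unfold Carg.
      destruct Rlt_dec; [reflexivity|contradiction].
    - apply (@continuous_mult C_UniformSpace R_AbsRing); [apply continuous_const|].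
      apply (@continuous_comp C_UniformSpace R_UniformSpace R_UniformSpace);
        [|apply continuous_atan].
      apply (@continuous_mult C_UniformSpace R_AbsRing); [exact HI|].
      apply (@continuous_comp C_UniformSpace R_UniformSpace R_UniformSpace
               (fun w => Cmod w + Re w) Rinv); [exact HS|].
      apply continuous_Rinv. lra. }
  intros P [eps HP].
  assert (H1 : locally w (fun y : C_UniformSpace => ball (ln (Cmod w)) eps (ln (Cmod y))))
    by exact (Hln _ (locally_ball _ eps)).
  assert (H2 : locally w (fun y : C_UniformSpace => ball (Carg w) eps (Carg y)))
    by exact (Harg _ (locally_ball _ eps)).
  change (locally w (fun y : C_UniformSpace => P (Clog y))).
  generalize (filter_and (F := locally w) _ _ H1 H2).
  apply (filter_imp (F := locally w)). intros y H. apply HP. exact H.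
Qed.

Lemma Clog_1 : Clog 1 = 0%C.
Proof.
  unfold Clog, Carg. rewrite Cmod_1, ln_1. destruct Rlt_dec as [_|H].
  - replace (Im 1 / (1 + Re 1)) with 0 by (simpl; field). now rewrite atan_0, Rmult_0_r.
  - exfalso. apply H. simpl. lra.
Qed.

Lemma Clog_eps (w : C) (eps : R) : 0 < Re w -> 0 < eps -> exists delta, 0 < delta /\
  forall y, Cmod (y - w) < delta -> Cmod (Clog y - Clog w) < eps.
Proof.
  intros Hw Heps.
  (* Neighbourhoods here are boxes of the product structure; a box of half-side d lies in a disc of
     radius sqrt 2 times d. *)
  assert (H2 : 0 < sqrt 2) by (apply sqrt_lt_R0; lra).
  assert (He : 0 < eps / sqrt 2) by now apply Rdiv_lt_0_compat.
  destruct (continuous_Clog w Hw _ (locally_ball _ (mkposreal _ He))) as [d Hd].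
  exists d. split; [apply cond_pos|]. intros y Hy.
  apply C_NormedModule_mixin_compat1 in Hy. apply Hd in Hy.
  apply C_NormedModule_mixin_compat2 in Hy. simpl in Hy.
  replace (sqrt 2 * (eps / sqrt 2)) with eps in Hy by (field; lra). exact Hy.
Qed.

(** This map recovers t from the logarithm - Log (1 - t) of the base, so it is the F to be inverted
    there. *)
Lemma is_derive_one_minus_Cexp_opp (l : C) :
  @is_derive C_AbsRing C_NormedModule (fun l => 1 - Cexp (- l))%C l (Cexp (- l)).
Proof.
  apply is_derive_C_eps. intros eps Heps.
  destruct (proj1 (is_derive_C_eps _ _ _) (is_derive_Cexp (- l)%C) eps Heps) as (d & Hd & H).
  exists d. split; [assumption|]. intros y Hy.
  assert (E : Cmod (- y - - l) = Cmod (y - l)).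
  { rewrite <- Cmod_opp. f_equal. ring. }
  specialize (H (- y)%C). rewrite E in H. specialize (H Hy).
  rewrite <- Cmod_opp in H.
  match type of H with Cmod ?u <= _ =>
    replace (1 - Cexp (- y) - (1 - Cexp (- l)) - (y - l) * Cexp (- l))%C with u by ring end.
  exact H.
Qed.

Lemma is_derive_cubic (t : C) :
  @is_derive C_AbsRing C_NormedModule (fun t => t * ((1 - t) * (1 - t)))%C t
    ((1 - t) * (1 - 3 * t))%C.
Proof.
  apply is_derive_C_eps. intros eps Heps.
  (* Bounds |h + 3 t - 2| for |h| <= 1, the cofactor of h^2 in the Taylor remainder of the cubic. *)
  set (M := 3 + 3 * Cmod t). assert (Ht := Cmod_ge_0 t).
  assert (HM : 0 < M) by (unfold M; lra).
  exists (Rmin 1 (eps / M)). split; [apply Rmin_pos; [lra|now apply Rdiv_lt_0_compat]|].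
  intros y Hy.
  assert (H1 := Rlt_le_trans _ _ _ Hy (Rmin_l _ _)).
  assert (H2 := Rlt_le_trans _ _ _ Hy (Rmin_r _ _)).
  set (h := (y - t)%C) in *. assert (Hh := Cmod_ge_0 h).
  replace y with (t + h)%C by (unfold h; ring).
  match goal with |- Cmod ?u <= _ => replace u with (h * (h * (h + (3 * t - 2))))%C by ring end.
  rewrite !Cmod_mult, (Rmult_comm eps). apply Rmult_le_compat_l; [assumption|].
  assert (HB : Cmod (h + (3 * t - 2)) <= M).
  { eapply Rle_trans; [apply Cmod_triangle|].
    generalize (Cmod_minus_le (3 * t) 2). rewrite Cmod_mult, !Cmod_R, !Rabs_pos_eq by lra.
    unfold M. lra. }
  apply Rle_trans with (eps / M * M); [|right; field; lra].
  apply Rmult_le_compat; try lra. apply Cmod_ge_0.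
Qed.

Lemma is_derive_C_id (z : C) : @is_derive C_AbsRing C_NormedModule (fun y => y) z (RtoC 1).
Proof.
  apply is_derive_C_eps. intros eps Heps. exists 1. split; [lra|]. intros y _.
  replace (y - z - (y - z) * 1)%C with (RtoC 0) by ring. rewrite Cmod_0.
  apply Rmult_le_pos; [lra|apply Cmod_ge_0].
Qed.

(** * The root [t = 4/3 sin^2 alpha] *)

Definition cubic_root (sq : C -> C) (z : C) : C := (4 / 3 * sin2a sq z)%C.

Section Root.

Variable sq : C -> C.
Hypothesis sq_sqr : forall w : C, (sq w * sq w = w)%C.
Local Notation t := (cubic_root sq).

Lemma sq_arg_lt_1 (z : C) : Cmod z < 4 / 27 -> Cmod (sq (27 * z / 4)%C) < 1.
Proof.
  intros Hz. assert (H := f_equal Cmod (sq_sqr (27 * z / 4)%C)).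
  rewrite Cmod_mult in H.
  replace (27 * z / 4)%C with (RtoC (27 / 4) * z)%C in H at 3
    by (rewrite RtoC_div by lra; field).
  rewrite Cmod_mult, Cmod_R, Rabs_pos_eq in H by lra.
  assert (H0 := Cmod_ge_0 (sq (27 * z / 4)%C)). nra.
Qed.

Lemma cubic_root_small (z : C) : Cmod z < 4 / 27 -> Cmod (t z) < 1 / 3.
Proof. intros Hz. apply arcsin_third_small. now apply sq_arg_lt_1. Qed.

Lemma cubic_root_eq (z : C) : Cmod z < 4 / 27 ->
  (t z * ((1 - t z) * (1 - t z)) = z)%C.
Proof.
  intros Hz. unfold cubic_root, sin2a, alpha.
  rewrite (arcsin_third_cubic _ (sq_arg_lt_1 z Hz)), sq_sqr. field.
Qed.

Lemma cos2a_eq (z : C) : cos2a sq z = (1 - 3 / 4 * t z)%C.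
Proof.
  generalize (Ccos_sqr_plus_Csin_sqr (alpha sq z)). intros H.
  unfold cubic_root, cos2a, sin2a. rewrite <- H. field.
Qed.

Lemma sin2a_eq (z : C) : sin2a sq z = (3 / 4 * t z)%C.
Proof. unfold cubic_root. field. Qed.

Lemma one_minus_neq_0 (z : C) : Cmod z < 1 -> (1 - z)%C <> 0%C.
Proof.
  intros Hz H. generalize (Cmod_sub_le 1 z). rewrite H, Cmod_0, Cmod_1. lra.
Qed.

Lemma base_eq (z : C) : Cmod z < 4 / 27 ->
  (3 / (3 * cos2a sq z - sin2a sq z) = / (1 - t z))%C.
Proof.
  intros Hz. rewrite cos2a_eq, sin2a_eq.
  assert (H := one_minus_neq_0 (t z) ltac:(generalize (cubic_root_small z Hz); lra)).
  replace (3 * (1 - 3 / 4 * t z) - 3 / 4 * t z)%C with (3 * (1 - t z))%C by field.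
  field. assumption.
Qed.

Lemma denominator_eq (z : C) : (cos2a sq z - 3 * sin2a sq z = 1 - 3 * t z)%C.
Proof. rewrite cos2a_eq, sin2a_eq. field. Qed.

(** Subtracting the cubic equations at y and z leaves (t z - t y) times a factor bounded below.
    Possible jumps of [sq] never enter. *)
Lemma cubic_root_lipschitz (y z : C) : Cmod y < 4 / 27 -> Cmod z < 4 / 27 ->
  Cmod (t y - t z) * ((1 / 3 - Cmod (t z)) * (4 / 3 - Cmod (t z))) <= Cmod (y - z).
Proof.
  intros Hy Hz.
  assert (E := cubic_diff_factor (t z) (t y)). rewrite !cubic_root_eq in E by assumption.
  replace (y - z)%C with (- (z - y))%C by ring.
  rewrite Cmod_opp, E, Cmod_mult, <- (Cmod_opp (t z - t y)).
  replace (- (t z - t y))%C with (t y - t z)%C by ring.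
  apply Rmult_le_compat_l; [apply Cmod_ge_0|].
  apply cubic_factor_lower; now apply cubic_root_small.
Qed.

Lemma disc_nbhd (y z : C) : Cmod (y - z) < 4 / 27 - Cmod z -> Cmod y < 4 / 27.
Proof. generalize (Cmod_sub_le y z). lra. Qed.

Lemma cubic_root_continuous (z : C) (eps : R) : Cmod z < 4 / 27 -> 0 < eps ->
  exists delta, 0 < delta /\ forall y, Cmod (y - z) < delta -> Cmod (t y - t z) < eps.
Proof.
  intros Hz Heps. assert (Ht := cubic_root_small z Hz).
  set (c := (1 / 3 - Cmod (t z)) * (4 / 3 - Cmod (t z))).
  assert (Hc : 0 < c) by (unfold c; nra).
  exists (Rmin (4 / 27 - Cmod z) (eps * c)). split; [apply Rmin_pos; nra|].
  intros y Hy.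
  assert (H1 := Rlt_le_trans _ _ _ Hy (Rmin_l _ _)).
  assert (H2 := Rlt_le_trans _ _ _ Hy (Rmin_r _ _)).
  assert (H := cubic_root_lipschitz y z (disc_nbhd _ _ H1) Hz). fold c in H.
  apply Rmult_lt_reg_r with c; lra.
Qed.

Lemma cubic_root_derive (z : C) : Cmod z < 4 / 27 ->
  exists l, @is_derive C_AbsRing C_NormedModule t z l.
Proof.
  intros Hz. assert (Ht := cubic_root_small z Hz). eexists.
  apply (is_derive_C_implicit (fun t => t * ((1 - t) * (1 - t)))%C t (fun y => y) z
           ((1 - t z) * (1 - 3 * t z))%C 1%C (4 / 27 - Cmod z)).
  - lra.
  - intros y Hy. now apply cubic_root_eq, (disc_nbhd y z).
  - intros eps Heps. now apply cubic_root_continuous.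
  - apply is_derive_cubic.
  - apply Cmult_neq_0; apply one_minus_neq_0; [lra|].
    rewrite Cmod_mult, Cmod_R, Rabs_pos_eq; lra.
  - apply is_derive_C_id.
Qed.

Lemma Re_one_minus_cubic_root (z : C) : Cmod z < 4 / 27 -> 0 < Re (1 - t z)%C.
Proof.
  intros Hz. assert (Ht := cubic_root_small z Hz).
  generalize (re_le_Cmod (t z)) (Rle_abs (Re (t z))).
  replace (Re (1 - t z)%C) with (1 - Re (t z)) by (destruct (t z); simpl; ring). lra.
Qed.

Lemma Cexp_log_base (z : C) : Cmod z < 4 / 27 ->
  Cexp (- Clog (1 - t z)) = (/ (1 - t z))%C.
Proof.
  intros Hz. assert (Hre := Re_one_minus_cubic_root z Hz).
  assert (H := one_minus_neq_0 (t z) ltac:(generalize (cubic_root_small z Hz); lra)).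
  assert (E := Cexp_opp (Clog (1 - t z))). rewrite Cexp_Clog in E by assumption.
  transitivity (/ (1 - t z) * ((1 - t z) * Cexp (- Clog (1 - t z))))%C.
  - field. assumption.
  - rewrite E. ring.
Qed.

Lemma log_base_derive (z : C) : Cmod z < 4 / 27 ->
  exists l, @is_derive C_AbsRing C_NormedModule (fun z => - Clog (1 - t z))%C z l.
Proof.
  intros Hz. destruct (cubic_root_derive z Hz) as [l Hl]. eexists.
  apply (is_derive_C_implicit (fun l => 1 - Cexp (- l))%C (fun z => - Clog (1 - t z))%C t z
           (Cexp (- - Clog (1 - t z))) l (4 / 27 - Cmod z)).
  - lra.
  - intros y Hy. assert (Hy' := disc_nbhd _ _ Hy).
    replace (- - Clog (1 - t y))%C with (Clog (1 - t y)) by ring.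
    rewrite Cexp_Clog by now apply Re_one_minus_cubic_root. ring.
  - intros eps Heps.
    destruct (Clog_eps (1 - t z)%C eps (Re_one_minus_cubic_root z Hz) Heps) as (d & Hd & H).
    destruct (cubic_root_continuous z d Hz Hd) as (d' & Hd' & H').
    exists d'. split; [assumption|]. intros y Hy.
    replace (- Clog (1 - t y) - - Clog (1 - t z))%C
      with (- (Clog (1 - t y) - Clog (1 - t z)))%C by ring.
    rewrite Cmod_opp. apply H. rewrite <- Cmod_opp.
    replace (- (1 - t y - (1 - t z)))%C with (t y - t z)%C by ring. now apply H'.
  - apply is_derive_one_minus_Cexp_opp.
  - apply Cexp_neq_0.
  - exact Hl.
Qed.

End Root.

(** * Identification along rays *)

Lemma is_derive_ray (f : C -> C) (z l : C) (x : R) :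
  @is_derive C_AbsRing C_NormedModule f (x * z)%C l ->
  is_derive_RC (fun y => f (RtoC y * z)%C) x (z * l)%C.
Proof.
  intros H. assert (Hz := Cmod_ge_0 z).
  assert (Hlim : forall eps, 0 < eps -> exists delta : posreal, forall h, h <> 0 ->
    Rabs h < delta ->
    Cmod (f (RtoC (x + h)%R * z) - f (RtoC x * z) - RtoC h * (z * l))%C <= eps * Rabs h).
  { intros eps Heps.
    assert (He : 0 < eps / (Cmod z + 1)) by (apply Rdiv_lt_0_compat; lra).
    destruct (proj1 (is_derive_C_eps _ _ _) H _ He) as (d & Hd & Hy).
    assert (Hd' : 0 < d / (Cmod z + 1)) by (apply Rdiv_lt_0_compat; lra).
    exists (mkposreal _ Hd'). intros h _ Hh. simpl in Hh.
    assert (Hk : (RtoC (x + h)%R * z - RtoC x * z = RtoC h * z)%C)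
      by (rewrite RtoC_plus; ring).
    assert (Hb : Cmod (RtoC h * z) <= Rabs h * (Cmod z + 1)).
    { rewrite Cmod_mult, Cmod_R. apply Rmult_le_compat_l; [apply Rabs_pos|lra]. }
    assert (Hlt : Rabs h * (Cmod z + 1) < d).
    { apply Rmult_lt_reg_r with (/ (Cmod z + 1)); [apply Rinv_0_lt_compat; lra|].
      rewrite Rmult_assoc, Rinv_r by lra. unfold Rdiv in Hh. lra. }
    specialize (Hy (RtoC (x + h)%R * z)%C). rewrite Hk in Hy.
    replace (RtoC h * (z * l))%C with (RtoC h * z * l)%C by ring.
    eapply Rle_trans; [apply Hy; lra|].
    apply Rle_trans with (eps / (Cmod z + 1) * (Rabs h * (Cmod z + 1)));
      [apply Rmult_le_compat_l; lra|right; field; lra]. }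
  (* [p] stands for [Re] and [Im]: both are real-linear and bounded by the modulus, so the complex
     estimate passes to each component. *)
  assert (Hcomp : forall p : C -> R,
    (forall u v h, p (u - v - RtoC h * (z * l))%C = p u - p v - h * p (z * l)%C :> R) ->
    (forall u, Rabs (p u) <= Cmod u) ->
    is_derive (fun y => p (f (RtoC y * z)%C)) x (p (z * l)%C)).
  { intros p Hp Hle. apply is_derive_Reals. intros eps Heps.
    destruct (Hlim (eps / 2) ltac:(lra)) as [d Hd]. exists d. intros h Hh Hhd.
    specialize (Hd h Hh Hhd). assert (Hh0 := Rabs_pos_lt h Hh).
    eapply Rle_lt_trans; [|instantiate (1 := eps / 2); lra].
    apply Rmult_le_reg_r with (Rabs h); [assumption|].
    rewrite <- Rabs_mult. eapply Rle_trans; [|exact Hd].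
    eapply Rle_trans; [|apply Hle]. rewrite Hp. right. f_equal. field. assumption. }
  split; apply Hcomp.
  - intros u v h. unfold Cminus, Cplus, Copp, Cmult, RtoC, Re, Im. simpl. ring.
  - apply re_le_Cmod.
  - intros u v h. unfold Cminus, Cplus, Copp, Cmult, RtoC, Re, Im. simpl. ring.
  - apply Im_le_Cmod.
Qed.

Lemma is_derive_RC_mult (f g : R -> C) (x : R) (l m : C) :
  is_derive_RC f x l -> is_derive_RC g x m ->
  is_derive_RC (fun y => f y * g y)%C x (l * g x + f x * m)%C.
Proof.
  intros [Hf1 Hf2] [Hg1 Hg2].
  assert (Hm : forall u v x du dv, is_derive u x du -> is_derive v x dv ->
    is_derive (fun y => u y * v y) x (du * v x + u x * dv)).
  { intros. apply (is_derive_mult u v); try assumption. intros; apply Rmult_comm. }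
  split.
  - replace (Re (l * g x + f x * m)%C)
      with (Re l * Re (g x) + Re (f x) * Re m - (Im l * Im (g x) + Im (f x) * Im m))
      by (unfold Cplus, Cmult, Re, Im; simpl; ring).
    apply (is_derive_minus (fun y => Re (f y) * Re (g y)) (fun y => Im (f y) * Im (g y)));
      apply Hm; assumption.
  - replace (Im (l * g x + f x * m)%C)
      with (Re l * Im (g x) + Re (f x) * Im m + (Im l * Re (g x) + Im (f x) * Re m))
      by (unfold Cplus, Cmult, Re, Im; simpl; ring).
    apply (is_derive_plus (fun y => Re (f y) * Im (g y)) (fun y => Im (f y) * Re (g y)));
      apply Hm; assumption.
Qed.

Lemma is_derive_RC_scal (k : R) (f : R -> C) (x : R) (l : C) :
  is_derive_RC f x l -> is_derive_RC (fun y => RtoC k * f y)%C x (RtoC k * l)%C.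
Proof.
  intros [H1 H2]. split.
  - replace (Re (RtoC k * l)%C) with (k * Re l)
      by (unfold Cmult, RtoC, Re, Im; simpl; ring).
    apply is_derive_ext with (fun y => k * Re (f y)); [|now apply is_derive_scal].
    intros y. unfold Cmult, RtoC, Re, Im. simpl. ring.
  - replace (Im (RtoC k * l)%C) with (k * Im l)
      by (unfold Cmult, RtoC, Re, Im; simpl; ring).
    apply is_derive_ext with (fun y => k * Im (f y)); [|now apply is_derive_scal].
    intros y. unfold Cmult, RtoC, Re, Im. simpl. ring.
Qed.

Lemma is_derive_RC_Cexp (f : R -> C) (x : R) (l : C) :
  is_derive_RC f x l -> is_derive_RC (fun y => Cexp (f y)) x (l * Cexp (f x))%C.
Proof.
  intros [H1 H2].
  assert (H : forall u v a b, is_derive u x a -> is_derive v x b ->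
    is_derive (fun y => exp (u y) * cos (v y)) x
      (a * (exp (u x) * cos (v x)) - b * (exp (u x) * sin (v x)))
    /\ is_derive (fun y => exp (u y) * sin (v y)) x
      (a * (exp (u x) * sin (v x)) + b * (exp (u x) * cos (v x)))).
  { intros u v a b Hu Hv.
    assert (Eu := is_derive_unique _ _ _ Hu). assert (Ev := is_derive_unique _ _ _ Hv).
    assert (Hu' : ex_derive u x) by now exists a.
    assert (Hv' : ex_derive v x) by now exists b.
    split; auto_derive; try tauto; change (fun y => u y) with u; change (fun y => v y) with v;
      rewrite Eu, Ev; ring. }
  exact (H _ _ _ _ H1 H2).
Qed.

Lemma is_derive_RC_unique (f : R -> C) (x : R) (l m : C) :
  is_derive_RC f x l -> is_derive_RC f x m -> l = m.
Proof.
  intros [H1 H2] [H3 H4].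
  apply is_derive_unique in H1, H2, H3, H4.
  destruct l, m. simpl in *. congruence.
Qed.

Lemma is_derive_RC_locally_ext (f g : R -> C) (x : R) (l : C) :
  locally x (fun y => f y = g y) -> is_derive_RC f x l -> is_derive_RC g x l.
Proof.
  intros H [H1 H2]. split.
  - refine (is_derive_ext_loc _ _ _ _ _ H1). revert H. apply filter_imp. now intros y ->.
  - refine (is_derive_ext_loc _ _ _ _ _ H2). revert H. apply filter_imp. now intros y ->.
Qed.

(** The mean value theorem for each component asks for differentiability on the closed interval but
    for a zero derivative only inside. The endpoints must be spared: at x = 0 the differential
    equation degenerates, and at x = 1 only one-sided information is available. *)
Lemma is_derive_RC_zero_endpoints (f : R -> C) :
  (forall x, 0 <= x <= 1 -> exists l, is_derive_RC f x l /\ (0 < x < 1 -> l = 0%C)) ->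
  f 1 = f 0.
Proof.
  intros H.
  assert (Hcomp : forall p : C -> R, p 0%C = 0 ->
    (forall x l, is_derive_RC f x l -> is_derive (fun y => p (f y)) x (p l)) ->
    p (f 1) = p (f 0)).
  { intros p Hp Hd.
    destruct (MVT_cor2 (fun y => p (f y)) (Derive (fun y => p (f y))) 0 1)
      as (c & Hc & Hc01); [lra| |].
    - intros c Hc. apply is_derive_Reals, Derive_correct.
      destruct (H c Hc) as (l & Hl & _). exists (p l). now apply Hd.
    - destruct (H c ltac:(lra)) as (l & Hl & Hl0).
      assert (E : Derive (fun y : R => p (f y)) c = p l) by apply is_derive_unique, Hd, Hl.
      rewrite E, Hl0, Hp in Hc by lra. lra. }
  assert (H1 := Hcomp Re eq_refl (fun x l h => proj1 h)).
  assert (H2 := Hcomp Im eq_refl (fun x l h => proj2 h)).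
  destruct (f 1), (f 0). simpl in *. congruence.
Qed.

(** * Comparison of the sums with the root and with the power *)

Lemma Cmod_ray (z : C) (x rho : R) : Cmod z < rho -> Rabs x <= 1 -> Cmod z * Rabs x < rho.
Proof. generalize (Cmod_ge_0 z) (Rabs_pos x). nra. Qed.

Lemma Cmod_ray_lt (z : C) (x rho : R) : Cmod z * Rabs x < rho -> Cmod (RtoC x * z) < rho.
Proof. rewrite Cmod_mult, Cmod_R. lra. Qed.

(** With T = 1 - 1/B the cubic is B = 1 + z B^3 divided by B^3, that is, the difference relation
    A_(-2) - A_(-3) = x z A_0 with A_0 = 1. *)
Lemma ray_root_eq (z : C) (x : R) : Cmod z * Rabs x < 4 / 27 ->
  let T := (1 - Aray (- (1)) z x)%C in (T * ((1 - T) * (1 - T)) = RtoC x * z)%C.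
Proof.
  intros Hx T. unfold T. clear T.
  assert (H := Aray_diff (- (2)) z x Hx).
  replace (- (2) + 2) with 0 in H by ring. rewrite Aray_0 in H by assumption.
  replace (- (2) - 1) with (- (1) + - (2)) in H by ring.
  rewrite <- Aray_mult in H by assumption.
  replace (- (2)) with (- (1) + - (1)) in H by ring.
  rewrite <- Aray_mult in H by assumption.
  replace (RtoC x * z)%C with (RtoC x * z * 1)%C by ring. rewrite <- H. ring.
Qed.

Lemma ray_root_small (z : C) (x : R) : Cmod z < 4 / 27 -> 0 <= x <= 1 ->
  Cmod (1 - Aray (- (1)) z x)%C < 1 / 3.
Proof.
  intros Hz Hx. set (T := fun y => (1 - Aray (- (1)) z y)%C).
  assert (Hne : forall y, 0 <= y <= 1 -> Cmod (T y) <> 1 / 3).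
  { intros y Hy Heq.
    assert (Hzy := Cmod_ray z y _ Hz ltac:(rewrite Rabs_pos_eq; lra)).
    assert (Hlow : 4 / 27 <= Cmod (T y * ((1 - T y) * (1 - T y)))%C).
    { apply cubic_lower_bound; [|lra].
      generalize (re_le_Cmod (T y)) (Rle_abs (Re (T y))). lra. }
    unfold T in Hlow. rewrite (ray_root_eq z y Hzy) in Hlow.
    apply Cmod_ray_lt in Hzy. lra. }
  apply Rnot_le_lt. intros Hge. fold (T x) in Hge.
  assert (Hgt : 1 / 3 < Cmod (T x)) by (specialize (Hne x Hx); lra).
  (* The squared modulus is polynomial in the components of [T], hence continuous by [Aray_derive];
     a zero of [g] is a point where |T| = 1/3. *)
  set (g := fun y => Re (T y) * Re (T y) + Im (T y) * Im (T y) - 1 / 3 * (1 / 3)).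
  assert (H0 : T 0 = 0%C).
  { unfold T, Aray. rewrite ray_sum_at_0, acoef_0. ring. }
  assert (Hx0 : 0 < x).
  { destruct (Req_dec x 0) as [->|]; [|lra]. rewrite H0, Cmod_0 in Hgt. lra. }
  assert (Hcont : forall y, 0 <= y <= x -> continuity_pt g y).
  { intros y Hy.
    assert (Hzy := Cmod_ray z y _ Hz ltac:(rewrite Rabs_pos_eq; lra)).
    destruct (Aray_derive (- (1)) z y Hzy) as (l & [D1 D2] & _).
    apply continuity_pt_filterlim. apply (ex_derive_continuous g y).
    unfold g, T. simpl. auto_derive. repeat split; eexists; eassumption. }
  destruct (IVT_interv g 0 x Hcont Hx0) as (c & Hc & Hgc).
  - unfold g. rewrite H0. simpl. lra.
  - unfold g. rewrite <- Cmod_sqr. nra.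
  - apply (Hne c); [lra|]. unfold g in Hgc. rewrite <- Cmod_sqr in Hgc.
    generalize (Cmod_ge_0 (T c)). intros. nra.
Qed.

Lemma ray_root_cubic_root (sq : C -> C) (sq_sqr : forall w : C, (sq w * sq w = w)%C)
    (z : C) (x : R) : Cmod z < 4 / 27 -> 0 <= x <= 1 ->
  (Aray (- (1)) z x = 1 - cubic_root sq (RtoC x * z))%C.
Proof.
  intros Hz Hx.
  assert (Hzx := Cmod_ray z x _ Hz ltac:(rewrite Rabs_pos_eq; lra)).
  assert (Hw := Cmod_ray_lt _ _ _ Hzx).
  rewrite <- (cubic_inj (1 - Aray (- (1)) z x)%C (cubic_root sq (RtoC x * z))).
  - ring.
  - now apply ray_root_small.
  - now apply cubic_root_small.
  - rewrite ray_root_eq, cubic_root_eq by assumption. reflexivity.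
Qed.

Lemma Aray_one_inv (z : C) (x : R) : Cmod z * Rabs x < 4 / 27 ->
  (Aray 1 z x = / Aray (- (1)) z x)%C.
Proof.
  intros Hx. assert (H := Aray_mult (- (1)) 1 z x Hx).
  replace (- (1) + 1) with 0 in H by ring. rewrite Aray_0 in H by assumption.
  assert (Hne : Aray (- (1)) z x <> 0%C).
  { intros E. rewrite E in H. apply C1_nz. rewrite <- H. ring. }
  transitivity (/ Aray (- (1)) z x * (Aray (- (1)) z x * Aray 1 z x))%C.
  - field. assumption.
  - rewrite H. ring.
Qed.

(** The relation A_0 = 3 D_(-1) - 2 D_0 reads 1 = D_0 (3 A_(-1) - 2) = D_0 (1 - 3 T), and
    multiplying by A_r gives the claim. This is where the second factor of the formula comes
    from. *)
Lemma Dray_eq (r : R) (z : C) (x : R) : Cmod z * Rabs x < 4 / 27 ->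
  (Dray r z x * (1 - 3 * (1 - Aray (- (1)) z x)) = Aray r z x)%C.
Proof.
  intros Hx.
  assert (H0 := Aray_Dray 0 z x Hx). rewrite Aray_0 in H0 by assumption.
  replace (0 - 1) with (0 + - (1)) in H0 by ring.
  rewrite <- Dray_mult in H0 by assumption.
  replace r with (0 + r) at 1 by ring. rewrite <- Dray_mult by assumption.
  transitivity (Aray r z x * (3 * (Dray 0 z x * Aray (- (1)) z x) - 2 * Dray 0 z x))%C;
    [ring|]. rewrite <- H0. ring.
Qed.

(* [B = exp L] and [A_r] satisfy [x A_r' / A_r = r x B' / B] along the ray, so
   [A_r exp (- r L)] is constant there. *)
Lemma Aray_power_branch (r : R) (L : C -> C) (z : C) : Cmod z < 4 / 27 ->
  analytic_on (open_disc (4 / 27)) L ->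
  (forall x, 0 <= x <= 1 -> Cexp (L (RtoC x * z)) = Aray 1 z x)%C ->
  Cexp (RtoC r * L 0)%C = 1%C ->
  Aray r z 1 = Cexp (RtoC r * L z)%C.
Proof.
  intros Hz HL HB H0.
  set (G := fun x => (Aray r z x * Cexp (RtoC (- r) * L (RtoC x * z)))%C).
  assert (HG : G 1 = G 0).
  { apply is_derive_RC_zero_endpoints. intros x Hx.
    assert (Hzx := Cmod_ray z x _ Hz ltac:(rewrite Rabs_pos_eq; lra)).
    destruct (Aray_derive r z x Hzx) as (y' & Hy & Ey).
    destruct (Aray_derive 1 z x Hzx) as (b' & Hb & Eb).
    destruct (HL _ (Cmod_ray_lt _ _ _ Hzx)) as (l & Hl).
    apply is_derive_ray in Hl. set (m := (z * l)%C) in *.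
    eexists. split.
    { apply is_derive_RC_mult; [exact Hy|].
      apply is_derive_RC_Cexp, is_derive_RC_scal, Hl. }
    intros Hx01. rewrite RtoC_opp.
    set (e := Cexp _). fold (Aray r z x).
    (* Identifying the two derivatives takes the equality exp L = A_1 on a two-sided neighbourhood
       of x, available only for 0 < x < 1. *)
    assert (Em : b' = (m * Aray 1 z x)%C).
    { rewrite <- (HB x Hx). apply (is_derive_RC_unique (Aray 1 z) x); [exact Hb|].
      apply is_derive_RC_locally_ext with (fun y => Cexp (L (RtoC y * z)%C));
        [|now apply is_derive_RC_Cexp].
      generalize (filter_and (F := locally x) _ _
        (open_gt 0 x (proj1 Hx01)) (open_lt 1 x (proj2 Hx01))).
      apply filter_imp. intros y Hy01. apply HB. lra. }
    assert (Hxne : RtoC x <> 0%C) by (apply RtoC_neq_0; lra).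
    assert (Hbne : Aray 1 z x <> 0%C) by (rewrite <- (HB x Hx); apply Cexp_neq_0).
    (* Exponent 1 determines D_0 - 1 in terms of the derivative [m] of L along the ray; inserted for
       exponent r it gives A_r' = r A_r m. *)
    assert (ED : (3 * RtoC x * m = Dray 0 z x - 1)%C).
    { transitivity (3 * (RtoC x * (m * Aray 1 z x)) / Aray 1 z x)%C; [field; assumption|].
      rewrite <- Em, Eb. field. assumption. }
    assert (Ey' : (y' = r * Aray r z x * m)%C).
    { transitivity (3 * (RtoC x * y') / (3 * RtoC x))%C; [field; assumption|].
      rewrite Ey, <- ED. field. assumption. }
    rewrite Ey'. ring. }
  assert (Hinv := Cexp_opp (RtoC r * L z)%C). assert (Hinv0 := Cexp_opp (RtoC r * L 0)%C).
  rewrite H0 in Hinv0. unfold G in HG. rewrite RtoC_opp in HG.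
  replace (RtoC 1 * z)%C with z in HG by ring.
  replace (RtoC 0 * z)%C with (RtoC 0) in HG by ring.
  replace (- RtoC r * L z)%C with (- (RtoC r * L z))%C in HG by ring.
  replace (- RtoC r * L 0)%C with (- (RtoC r * L 0))%C in HG by ring.
  replace (Cexp (- (RtoC r * L 0))) with (RtoC 1) in HG by (rewrite <- Hinv0; ring).
  unfold Aray at 2 in HG. rewrite ray_sum_at_0, acoef_0 in HG.
  transitivity (Cexp (RtoC r * L z) * (Aray r z 1 * Cexp (- (RtoC r * L z))))%C.
  - transitivity (Aray r z 1 * (Cexp (RtoC r * L z) * Cexp (- (RtoC r * L z))))%C; [|ring].
    rewrite Hinv. ring.
  - rewrite HG. ring.
Qed.

Open Scope C_scope.

Theorem corollary2p3 (r : R) (sq : C -> C)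
    (sq_sqr : forall w : C, sq w * sq w = w) :
  let base := fun z : C => 3 / (3 * cos2a sq z - sin2a sq z) in
  (exists P : C -> C, is_power_branch (open_disc (4 / 27)) base r P) /\
  (forall P : C -> C, is_power_branch (open_disc (4 / 27)) base r P ->
   forall z : C, (Cmod z < 4 / 27)%R ->
     is_Dseries 3 r z (P z * (1 / (cos2a sq z - 3 * sin2a sq z)))).
Proof.
  intros base.
  assert (Hbase : forall z, (Cmod z < 4 / 27)%R -> base z = / (1 - cubic_root sq z))
    by (intros z Hz; now apply base_eq).
  assert (H0disc : (Cmod 0 < 4 / 27)%R) by (rewrite Cmod_0; lra).
  split.
  (* As Re (1 - t) > 0, the principal logarithm stays off its cut. The existence of this branch
     keeps the second claim from being vacuous. *)
  - set (L := fun z => - Clog (1 - cubic_root sq z)).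
    assert (Ht0 : cubic_root sq 0 = 0).
    (* Both t(0) and 0 are small roots of the cubic for z = 0, so the arcsine need not be
       evaluated. *)
    { apply cubic_inj; [now apply cubic_root_small|rewrite Cmod_0; lra|].
      rewrite cubic_root_eq by assumption. ring. }
    exists (fun z => Cexp (RtoC r * L z)). split.
    + unfold L. rewrite Ht0. replace (1 - 0) with (RtoC 1) by ring. rewrite Clog_1.
      replace (r * - 0) with (RtoC 0) by ring. apply Cexp_0.
    + exists L. split; [|split; [|reflexivity]].
      * intros z Hz. now apply log_base_derive.
      * intros z Hz. rewrite (Hbase z Hz). now apply Cexp_log_base.
  - intros P (HP0 & L & HL & HLb & HPL) z Hz.
    assert (Hz1 := Cmod_ray z 1 _ Hz ltac:(rewrite Rabs_R1; lra)).
    assert (HT := ray_root_cubic_root sq sq_sqr z 1 Hz ltac:(lra)).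
    rewrite Cmult_1_l in HT.
    assert (HA : Aray r z 1 = P z).
    { rewrite (HPL z Hz). apply Aray_power_branch; try assumption.
      - intros x Hx.
        assert (Hzx := Cmod_ray z x _ Hz ltac:(rewrite Rabs_pos_eq; lra)).
        assert (Hw := Cmod_ray_lt _ _ _ Hzx).
        rewrite (HLb _ Hw), (Hbase _ Hw), Aray_one_inv by assumption.
        now rewrite (ray_root_cubic_root sq sq_sqr).
      (* L may take any value 2 pi i k at 0; the normalization P 0 = 1 is what forces exp (r L 0) =
         1. *)
      - rewrite <- HP0. symmetry. now apply HPL. }
    rewrite denominator_eq, <- HA.
    assert (HD := Dray_eq r z 1 Hz1). rewrite HT in HD.
    replace (1 - (1 - cubic_root sq z)) with (cubic_root sq z) in HD by ring.
    assert (Ht := cubic_root_small sq sq_sqr z Hz).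
    assert (Hne : 1 - 3 * cubic_root sq z <> 0).
    { apply one_minus_neq_0. rewrite Cmod_mult, Cmod_R, Rabs_pos_eq; lra. }
    replace (Aray r z 1 * (1 / (1 - 3 * cubic_root sq z))) with (Dray r z 1)
      by (rewrite <- HD; field; assumption).
    apply (ray_sum_is_pseries (dcoef r) z (4 / 27)); [apply CV_radius_dcoef|assumption].
Qed.
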